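(* (i) Let $\lambda_{\max}>0$, let $h,q$ be continuous real functions on $[0,\lambda_{\max})$, and let $w,v$ be the solutions of $\ddot w=(h+q)w$ and $\ddot v=hv$ on $[0,\lambda_{\max})$ with $w(0)=v(0)=0$, $\dot w(0)=\dot v(0)=1$. Assume $v>0$ on $(0,\lambda_{\max})$ and that $$X(\lambda)=\int_\lambda^{\lambda_{\max}}\frac{d\lambda'}{v^2(\lambda')}$$ is finite for $\lambda\in(0,\lambda_{\max})$; $X$ is strictly decreasing, so functions of $\lambda$ may be regarded as functions of $X$. Then $a:=w/v$ satisfies $$\frac{d^2a}{dX^2}=v^4\,q\,a,$$ with $a\to1$ and $\frac{da}{d\lambda}\to0$ as $\lambda\to0$. (ii) (Relative optical focusing equation.) In the on-average Friedmann universe setting of the context, with $\chi(z)=\int_z^\infty\frac{dz'}{r^2(z')(1+z')^3\sqrt{\Omega z'+1}}$ as independent variable, the function $a=\operatorname{sign}(\det A)\sqrt{|\det A|}$, $A(\lambda)=\mathcal{D}(\lambda)/D(\lambda)$, satisfies, on the $\lambda$-intervals between the vertex and consecutive conjugate points, $$\frac{d^2a}{d\chi^2}=\Big(\frac{c}{H_0}\Big)^2r^4\,\big[\mathcal{R}_{\rm cl}-|\sigma|^2\big]\,a .$$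
   Context: Dots denote $d/d\lambda$. Setting for (ii): $c,H_0>0$ are constants, $\Omega\ge0$ the density parameter, $\tilde\alpha\in[0,1]$. The affine parameter and the redshift $z\geq 0$ are related by $\lambda(z)=\frac{c}{H_0}\int_0^z\frac{dz'}{(1+z')^3\sqrt{\Omega z'+1}}$, a strictly increasing function, so quantities may be regarded as functions of $\lambda$, $z$ or $\chi$. The background source of convergence is $\mathcal{R}_{\rm bg}=-\frac32\left(\frac{H_0}{c}\right)^2\tilde\alpha\,\Omega\,(1+z)^5$. The empty-cone angular diameter distance $D(\lambda)=\frac{c}{H_0}r(z(\lambda))$ is the solution of $\ddot D=\mathcal{R}_{\rm bg}D$, $D(0)=0$, $\dot D(0)=1$; it is positive for $z>0$. The optical tidal matrix is $$\mathcal{T}=\begin{pmatrix}\mathcal{R}-\operatorname{Re}\mathcal{F}&\operatorname{Im}\mathcal{F}\\ \operatorname{Im}\mathcal{F}&\mathcal{R}+\operatorname{Re}\mathcal{F}\end{pmatrix},\qquad \mathcal{R}=\mathcal{R}_{\rm bg}+\mathcal{R}_{\rm cl},$$ with $\mathcal{R}_{\rm cl}$ real and $\mathcal{F}$ complex valued (contributions of matter clumps), continuous in $\lambda$. The Jacobi map $\mathcal{D}$ solves $\ddot{\mathcal{D}}=\mathcal{T}\mathcal{D}$, $\mathcal{D}(0)=0$, $\dot{\mathcal{D}}(0)=I$ ($2\times2$ matrices). Conjugate points are the $\lambda>0$ with $\det\mathcal{D}(\lambda)=0$. Where $\mathcal{D}$ is invertible, $\mathcal{S}=\dot{\mathcal{D}}\mathcal{D}^{-1}$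 is symmetric and the expansion $\theta\in\mathbb{R}$ and shear rate $\sigma\in\mathbb{C}$ are defined by $\mathcal{S}=\begin{pmatrix}\theta-\operatorname{Re}\sigma&\operatorname{Im}\sigma\\ \operatorname{Im}\sigma&\theta+\operatorname{Re}\sigma\end{pmatrix}$. *)

(* Defs.v *)
From Stdlib Require Import Reals.
From Coquelicot Require Import Coquelicot.
Open Scope R_scope.

(* [w'' = g w], [w 0 = 0], [w' 0 = 1] on [D], with [w1] in the role of [w'].
   [D_in] is the derivative relative to [D], hence one-sided at the vertex 0. *)
Definition vertex_ivp (D : R -> Prop) (g w w1 : R -> R) : Prop :=
  w 0 = 0 /\ w1 0 = 1 /\
  forall l, D l -> D_in w w1 D l /\ D_in w1 (fun s => g s * w s) D l.

(* The quantity [f], given as a function of [l] in [D], satisfies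
   [d^2 f / dx^2 = g] when regarded as a function of [x]: here [F] is [f] as a
   function of [x] and [F1] is its first derivative.  This is meant for [D] an
   open interval on which [x] is continuous and strictly monotone, so that [F]
   exists and the two-sided derivatives depend only on its values on [x(D)]. *)
Definition second_derivative_wrt (D : R -> Prop) (x f g : R -> R) : Prop :=
  forall F : R -> R, (forall l, D l -> F (x l) = f l) ->
  exists F1 : R -> R, forall l, D l ->
    is_derive F (x l) (F1 (x l)) /\ is_derive F1 (x l) (g l).

Definition entry (M : matrix 2 2) (i j : nat) : R := coeff_mat 0 M i j.

Definition mat2 (a b c d : R) : matrix 2 2 :=
  mk_matrix 2 2 (fun i j =>
    match i, j with
    | O, O => a | O, _ => b
    | _, O => c | _, _ => d
    end).

Definition det2 (M : matrix 2 2) : R :=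
  entry M 0 0 * entry M 1 1 - entry M 0 1 * entry M 1 0.

Definition inv2 (M : matrix 2 2) : matrix 2 2 :=
  mat2 (entry M 1 1 / det2 M) (- entry M 0 1 / det2 M)
       (- entry M 1 0 / det2 M) (entry M 0 0 / det2 M).

Definition scale2 (k : R) (M : matrix 2 2) : matrix 2 2 :=
  mk_matrix 2 2 (fun i j => k * entry M i j).

Definition derivative2 (D : R -> Prop) (M M1 : R -> matrix 2 2) : Prop :=
  forall i j : nat, (i < 2)%nat -> (j < 2)%nat ->
  forall l, D l ->
    D_in (fun s => entry (M s) i j) (fun s => entry (M1 s) i j) D l.

(* The common shape of the optical tidal matrix (e = R, s = F) and of the
   deformation rate matrix (e = theta, s = sigma). *)
Definition optical_mx (e : R) (s : C) : matrix 2 2 :=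
  mat2 (e - Re s) (Im s) (Im s) (e + Re s).

Definition jacobi_map (D : R -> Prop) (T Jac Jac1 : R -> matrix 2 2) : Prop :=
  Jac 0 = Mzero /\ Jac1 0 = (Mone : matrix (T := R_Ring) 2 2) /\
  derivative2 D Jac Jac1 /\
  derivative2 D Jac1 (fun l => Mmult (T := R_Ring) (T l) (Jac l)).

Definition conjugate_point (D : R -> Prop) (Jac : R -> matrix 2 2) (l : R)
  : Prop :=
  D l /\ 0 < l /\ det2 (Jac l) = 0.

Definition deformation_rate (Jac Jac1 : R -> matrix 2 2) (l : R)
  : matrix 2 2 :=
  Mmult (T := R_Ring) (Jac1 l) (inv2 (Jac l)).

Definition affine (c H0 Om z : R) : R :=
  c / H0 * RInt (fun s => / ((1 + s) ^ 3 * sqrt (Om * s + 1))) 0 z.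

(* The values of the affine parameter at redshifts [z >= 0]. *)
Definition affine_dom (c H0 Om l : R) : Prop :=
  exists z, 0 <= z /\ affine c H0 Om z = l.

(* The inverse function of [affine]: [iota] is definite description. *)
Definition redshift (c H0 Om l : R) : R :=
  iota (fun z : R => 0 <= z /\ affine c H0 Om z = l).

Definition R_bg (c H0 Om alpha l : R) : R :=
  - (3 / 2) * (H0 / c) ^ 2 * alpha * Om * (1 + redshift c H0 Om l) ^ 5.

Definition chi_integrand (Om : R) (r : R -> R) (z : R) : R :=
  / (r z ^ 2 * (1 + z) ^ 3 * sqrt (Om * z + 1)).

Definition chi (Om : R) (r : R -> R) (z : R) : R :=
  RInt_gen (chi_integrand Om r) (at_point z) (Rbar_locally p_infty).

Definition signed_root_det (A : matrix 2 2) : R :=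
  sign (det2 A) * sqrt (Rabs (det2 A)).

(* Main.v *)
(* Write N = w' v - w v' for the Wronskian of two solutions of w'' = (h + q) w,
   v'' = h v.  With x' = - k / v^2, the derivative of w / v with respect to x is
   - N / k, and N' = q w v, which gives d^2 (w / v) / dx^2 = v^4 q (w / v) / k^2.
   This is (i) with k = 1, and it is (ii) with k = c / H0, v = D and
   w = b := sign (det J) sqrt |det J|, because the trace of the Riccati equation
   S' = T - S^2 turns into b'' = (R - |sigma|^2) b.

   The positivity of D and the convergence of chi come from Sturm comparison, in
   the redshift coordinate, with u = sqrt (Om z + 1) / (1 + z)^2, a positive
   solution of the focusing equation for alpha = 1.  As long as D > 0, the
   Wronskian W = D' u - D u' is nondecreasing, so D / u increases and D never
   returns to 0; and 1 / D^2 = - (u / D)' / W <= - (u / D)' / W(0) is integrable up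
   to infinite redshift. *)

Require Import Defs.
From Stdlib Require Import Reals Lra Lia.
From Coquelicot Require Import Coquelicot.
Open Scope R_scope.

(** * Calculus on intervals starting at the vertex *)

(** Two obstacles shape the development. The solutions live on domains that begin at the vertex,
    where only one-sided derivatives are available: their equations are stated with [D_in], and
    two-sided derivatives are drawn from them only in the interior. In (ii) the affine parameter
    ends at a finite value known only as a limit, whereas the redshift runs over a half-line and is
    the variable in which chi is an integral and the comparison solution is explicit; hence the
    comparison is made in the redshift, with the equations written as first-order systems weighted
    by dlambda/dz. One comparison solution serves every alpha, because [R_bg] is smallest at alpha =
    1. The equation for b is obtained at the level of determinants: for d = det J one has d'' = (tr
    T) d + 2 det J' and b' / b = d' / (2 d). *)

Lemma R_ball (x y e : R) : ball x e y <-> Rabs (y - x) < e.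
Proof. reflexivity. Qed.

Lemma locally_R (x : R) (P : R -> Prop) :
  locally x P <-> exists d, 0 < d /\ forall y, Rabs (y - x) < d -> P y.
Proof.
  split.
  - intros [d Hd]. exists d. split; [apply cond_pos | exact Hd].
  - intros [d [Hd H]]. exists (mkposreal d Hd). exact H.
Qed.

Lemma locally_open_interval (a b l : R) :
  a < l < b -> locally l (fun s => a < s < b).
Proof.
  intros Hl. apply locally_R. exists (Rmin (l - a) (b - l)). split.
  - apply Rmin_pos; lra.
  - intros y Hy. pose proof (Rmin_l (l - a) (b - l)). pose proof (Rmin_r (l - a) (b - l)).
    apply Rabs_def2 in Hy. lra.
Qed.

(** [D_in] reads its derivative function only at the point itself, so the expression produced by a
    product rule may be traded for any other that agrees with it there. *)
Lemma D_in_change (f d d' : R -> R) (D : R -> Prop) (x : R) :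
  d x = d' x -> D_in f d D x -> D_in f d' D x.
Proof. unfold D_in. intros ->. auto. Qed.

Lemma D_in_is_derive (f d : R -> R) (D : R -> Prop) (x : R) :
  locally x D -> D_in f d D x -> is_derive f x (d x).
Proof.
  intros HD Hf. apply is_derive_Reals. intros eps He.
  apply locally_R in HD. destruct HD as [e [Hepos HD]].
  destruct (Hf eps He) as [alp [Ha H]].
  exists (mkposreal (Rmin e alp) (Rmin_pos _ _ Hepos Ha)). simpl. intros h Hh Hhd.
  pose proof (Rmin_l e alp). pose proof (Rmin_r e alp).
  specialize (H (x + h)). simpl in H. unfold Rdist in H.
  replace (x + h - x) with h in H by ring.
  apply H. split; [| lra]. split; [| lra]. apply HD. replace (x + h - x) with h by ring. lra.
Qed.

Lemma is_derive_D_in (f d : R -> R) (D : R -> Prop) (x : R) :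
  is_derive f x (d x) -> D_in f d D x.
Proof.
  intros Hf. apply is_derive_Reals in Hf. intros eps He.
  destruct (Hf eps He) as [del H]. exists del. split; [apply cond_pos |].
  intros y [[_ Hxy] Hy]. simpl in *. unfold Rdist in *.
  specialize (H (y - x)). replace (x + (y - x)) with y in H by ring.
  apply H; lra.
Qed.

Lemma D_in_continuous_within (f d : R -> R) (D : R -> Prop) (x : R) :
  D_in f d D x -> filterlim f (within D (locally x)) (locally (f x)).
Proof.
  intros Hf. apply cont_deriv in Hf. apply filterlim_locally. intros eps.
  destruct (Hf eps (cond_pos eps)) as [alp [Ha H]]. apply locally_R.
  exists alp. split; [exact Ha |]. intros y Hy HDy.
  destruct (Req_dec x y) as [-> | Hne]; [apply ball_center |].
  apply R_ball. apply (H y). repeat split; assumption.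
Qed.

Lemma filterlim_within_locally (f : R -> R) (D : R -> Prop) (x e : R) :
  filterlim f (within D (locally x)) (locally (f x)) -> 0 < e ->
  exists d, 0 < d /\ forall y, Rabs (y - x) < d -> D y -> Rabs (f y - f x) < e.
Proof.
  intros Hf He. apply filterlim_locally with (eps := mkposreal e He) in Hf.
  apply locally_R in Hf. destruct Hf as [d [Hd H]]. exists d. split; [exact Hd | exact H].
Qed.

Lemma is_derive_continuous (f : R -> R) (x l : R) : is_derive f x l -> continuous f x.
Proof. intros H. apply (@ex_derive_continuous R_AbsRing R_NormedModule). exists l. exact H. Qed.

(** Such a [D] is empty or of the form [0, b) with b possibly infinite. The end b is never named,
    because for the affine parameter it is only implicit. *)
Definition vertex_domain (D : R -> Prop) : Prop :=
  forall l, D l -> 0 <= l /\ exists l', l < l' /\ forall m, 0 <= m < l' -> D m.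

Lemma vertex_domain_between (D : R -> Prop) (l m : R) :
  vertex_domain D -> D l -> 0 <= m <= l -> D m.
Proof. intros HD Hl Hm. destruct (HD l Hl) as [_ [l' [Hl' H]]]. apply H. lra. Qed.

Lemma vertex_domain_locally (D : R -> Prop) (l : R) :
  vertex_domain D -> D l -> 0 < l -> locally l D.
Proof.
  intros HD Hl Hp. destruct (HD l Hl) as [_ [l' [Hl' H]]].
  apply filter_imp with (fun s => 0 < s < l'); [intros s Hs; apply H; lra |].
  apply locally_open_interval. lra.
Qed.

Lemma vertex_domain_is_derive (D : R -> Prop) (f f1 : R -> R) (l : R) :
  vertex_domain D -> D l -> 0 < l -> D_in f f1 D l -> is_derive f l (f1 l).
Proof. intros HD Hl Hp. apply D_in_is_derive. apply vertex_domain_locally; assumption. Qed.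

Lemma MVT_is_derive (f f1 : R -> R) (a b : R) :
  a < b ->
  (forall c, a < c < b -> is_derive f c (f1 c)) ->
  (forall c, a <= c <= b -> continuity_pt f c) ->
  exists c, a < c < b /\ f b - f a = f1 c * (b - a).
Proof.
  intros Hab Hd Hc.
  assert (pr1 : forall c, a < c < b -> derivable_pt f c).
  { intros c Hcc. exists (f1 c). apply is_derive_Reals. auto. }
  assert (pr2 : forall c, a < c < b -> derivable_pt id c).
  { intros c _. apply derivable_pt_id. }
  destruct (MVT f id a b pr1 pr2 Hab Hc) as [c [Hcc He]].
  { intros c _. apply derivable_continuous_pt. apply derivable_pt_id. }
  exists c. split; [exact Hcc |].
  rewrite (derive_pt_eq_0 id c 1 (pr2 c Hcc) (derivable_pt_lim_id c)) in He.
  rewrite (derive_pt_eq_0 f c (f1 c) (pr1 c Hcc)) in He.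
  - unfold id in He. lra.
  - apply is_derive_Reals. auto.
Qed.

(* At the vertex [f] is only continuous from the right, so the mean value
   theorem is applied to [f] extended by the constant [f 0] to the left. *)
Lemma vertex_MVT (D : R -> Prop) (f f1 : R -> R) (a b : R) :
  vertex_domain D -> (forall l, D l -> D_in f f1 D l) ->
  0 <= a < b -> D b ->
  exists c, a < c < b /\ f b - f a = f1 c * (b - a).
Proof.
  intros HD Hf Hab Hb.
  assert (Hin : forall c, 0 <= c <= b -> D c).
  { intros c Hc. apply (vertex_domain_between D b); assumption. }
  set (g := fun s => f (Rmax 0 s)).
  assert (Hg : forall s, 0 <= s -> g s = f s).
  { intros s Hs. unfold g. rewrite Rmax_right; auto. }
  assert (Hgd : forall c, 0 < c <= b -> is_derive g c (f1 c)).
  { intros c Hc. apply is_derive_ext_loc with f.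
    - apply filter_imp with (fun s => 0 < s < c + 1).
      + intros s Hs. symmetry. apply Hg. lra.
      + apply locally_open_interval. lra.
    - apply (vertex_domain_is_derive D); auto; try lra; [apply Hin | apply Hf, Hin]; lra. }
  destruct (MVT_is_derive g f1 a b) as [c [Hc He]]; [lra | | |].
  - intros c Hc. apply Hgd. lra.
  - intros c Hc. apply continuity_pt_filterlim.
    destruct (Req_dec c 0) as [-> | Hne].
    + assert (H0 : D 0) by (apply Hin; lra).
      apply filterlim_locally. intros eps.
      destruct (filterlim_within_locally f D 0 eps (D_in_continuous_within f f1 D 0 (Hf 0 H0)) (cond_pos eps))
        as [d [Hd H]].
      apply locally_R. exists (Rmin d b). split; [apply Rmin_pos; lra |].
      intros y Hy. apply R_ball. rewrite (Hg 0); [| lra]. unfold g.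
      pose proof (Rmin_l d b). pose proof (Rmin_r d b). apply Rabs_def2 in Hy.
      apply H.
      * rewrite Rminus_0_r, Rabs_pos_eq; [| apply Rmax_l]. apply Rmax_lub_lt; lra.
      * apply Hin. split; [apply Rmax_l | apply Rmax_lub; lra].
    + apply (is_derive_continuous g c (f1 c)). apply Hgd. lra.
  - exists c. split; [exact Hc |]. rewrite !Hg in He; lra.
Qed.

(** Division-free form of differentiability: it includes [y = x], and error bounds for two functions
    can be combined before any quotient is formed. *)
Lemma is_derive_linear_error (f : R -> R) (x l e : R) :
  is_derive f x l -> 0 < e ->
  exists d, 0 < d /\ forall y, Rabs (y - x) < d ->
    Rabs (f y - f x - l * (y - x)) <= e * Rabs (y - x).
Proof.
  intros Hf He. apply is_derive_Reals in Hf. destruct (Hf e He) as [d H].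
  exists d. split; [apply cond_pos |]. intros y Hy.
  destruct (Req_dec (y - x) 0) as [Hz | Hz].
  - replace y with x by lra. replace (f x - f x - l * (x - x)) with 0 by ring.
    rewrite Rabs_R0. apply Rmult_le_pos; [lra | apply Rabs_pos].
  - specialize (H (y - x) Hz Hy). replace (x + (y - x)) with y in H by ring.
    replace (f y - f x - l * (y - x)) with (((f y - f x) / (y - x) - l) * (y - x)) by (field; exact Hz).
    rewrite Rabs_mult. apply Rmult_le_compat_r; [apply Rabs_pos | lra].
Qed.

(* [F] need only satisfy [F o x = f]: near [x l] every point is a value of
   [x], so the difference quotients of [F] are quotients of increments of [f]
   and [x]. *)
Lemma is_derive_wrt (x f F : R -> R) (l x1 f1 : R) :
  locally l (fun s => continuous x s /\ F (x s) = f s) ->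
  is_derive x l x1 -> x1 <> 0 -> is_derive f l f1 ->
  is_derive F (x l) (f1 / x1).
Proof.
  intros Hloc Hx Hx1 Hf. apply locally_R in Hloc. destruct Hloc as [d0 [Hd0 Hloc]].
  assert (HFl : F (x l) = f l) by (apply Hloc; rewrite Rminus_diag, Rabs_R0; lra).
  apply is_derive_Reals. intros eps Heps.
  assert (Hax : 0 < Rabs x1) by (apply Rabs_pos_lt; exact Hx1).
  set (k := f1 / x1).
  assert (He2 : 0 < eps * Rabs x1 / 4) by nra.
  (* [f - k x] is stationary at [l]. An error of [eps |x1| / 4] per unit of [|s - l|] becomes
     [eps / 2] per unit of [|x s - x l|], because the latter is at least [|x1| / 2] times
     [|s - l|]. *)
  destruct (is_derive_linear_error (fun s => f s - k * x s) l 0 (eps * Rabs x1 / 4)) as [d1 [Hd1 H1]].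
  { replace 0 with (f1 - k * x1) by (unfold k; field; exact Hx1).
    apply (@is_derive_minus R_AbsRing R_NormedModule f (fun s => k * x s)); [exact Hf |].
    apply (is_derive_scal x l k x1). exact Hx. }
  { exact He2. }
  destruct (is_derive_linear_error x l x1 (Rabs x1 / 2) Hx) as [d2 [Hd2 H2]]; [lra |].
  set (d := Rmin d0 (Rmin d1 d2) / 2).
  assert (Hd : 0 < d /\ d < d0 /\ d < d1 /\ d < d2).
  { assert (0 < Rmin d0 (Rmin d1 d2)) by (repeat apply Rmin_pos; assumption).
    pose proof (Rmin_l d0 (Rmin d1 d2)). pose proof (Rmin_r d0 (Rmin d1 d2)).
    pose proof (Rmin_l d1 d2). pose proof (Rmin_r d1 d2). unfold d. lra. }
  clearbody d.
  assert (Hxs : forall s, Rabs (s - l) <= d -> Rabs x1 / 2 * Rabs (s - l) <= Rabs (x s - x l)).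
  { intros s Hs. specialize (H2 s ltac:(lra)).
    assert (Rabs (x1 * (s - l)) <= Rabs (x s - x l) + Rabs (x s - x l - x1 * (s - l))).
    { replace (x1 * (s - l)) with ((x s - x l) - (x s - x l - x1 * (s - l))) at 1 by ring.
      eapply Rle_trans; [apply Rabs_triang |]. rewrite Rabs_Ropp. lra. }
    rewrite Rabs_mult in H. lra. }
  assert (Hfs : forall s, Rabs (s - l) <= d ->
            Rabs (f s - f l - k * (x s - x l)) <= eps / 2 * Rabs (x s - x l)).
  { intros s Hs. specialize (H1 s ltac:(lra)). specialize (Hxs s Hs).
    replace (f s - f l - k * (x s - x l))
      with (f s - k * x s - (f l - k * x l) - 0 * (s - l)) by ring.
    nra. }
  (* The values of [x] at [l - d] and [l + d] lie on opposite sides of [x l], at distance at least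
     [|x1| d / 2]; the intermediate value theorem then reaches every [x l + h] with [h] below this
     radius. *)
  exists (mkposreal (Rabs x1 / 2 * d) ltac:(nra)). simpl. intros h Hh Hhd.
  assert (Hsurj : exists s, Rabs (s - l) <= d /\ x s = x l + h).
  { assert (Hc : forall s, l - d <= s <= l + d -> continuity_pt x s).
    { intros s Hs. apply continuity_pt_filterlim. apply Hloc. apply Rabs_def1; lra. }
    assert (Hp : Rabs (l + d - l) = d) by (rewrite Rabs_pos_eq; lra).
    assert (Hm : Rabs (l - d - l) = d) by (rewrite Rabs_left; lra).
    pose proof (H2 (l + d) ltac:(lra)) as Hup. pose proof (H2 (l - d) ltac:(lra)) as Hlo.
    rewrite Hp in Hup. rewrite Hm in Hlo.
    apply Rabs_le_between in Hup. apply Rabs_le_between in Hlo. apply Rabs_def2 in Hhd.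
    destruct (Rlt_le_dec 0 x1) as [Hs | Hs].
    - rewrite (Rabs_pos_eq x1) in *; try lra.
      destruct (Ranalysis5.f_interv_is_interv x (l - d) (l + d) (x l + h)) as [s [Hs1 Hs2]];
        [lra | nra | exact Hc |].
      exists s. split; [apply Rabs_le_between; lra | exact Hs2].
    - rewrite (Rabs_left x1) in *; try lra.
      destruct (Ranalysis5.f_interv_is_interv (fun s => - x s) (l - d) (l + d) (- (x l + h))) as [s [Hs1 Hs2]];
        [lra | nra | intros s Hs'; apply (continuity_pt_opp x); auto |].
      exists s. split; [apply Rabs_le_between; lra | lra]. }
  destruct Hsurj as [s [Hs Hxsh]]. specialize (Hfs s Hs).
  replace (F (x l + h)) with (f s) by (rewrite <- Hxsh; symmetry; apply Hloc; lra).
  rewrite HFl. fold k. replace h with (x s - x l) in * by lra.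
  replace ((f s - f l) / (x s - x l) - k) with ((f s - f l - k * (x s - x l)) / (x s - x l)) by (field; exact Hh).
  unfold Rdiv. rewrite Rabs_mult, Rabs_inv.
  assert (0 < Rabs (x s - x l)) by (apply Rabs_pos_lt; exact Hh).
  apply Rmult_lt_reg_r with (Rabs (x s - x l)); [assumption |].
  rewrite Rmult_assoc, Rinv_l by lra. nra.
Qed.

(** * Change of independent variable *)

Lemma is_derive_Rmult (f g : R -> R) (x df dg : R) :
  is_derive f x df -> is_derive g x dg ->
  is_derive (fun s => f s * g s) x (df * g x + f x * dg).
Proof. intros Hf Hg. apply (@is_derive_mult R_AbsRing f g); auto. exact Rmult_comm. Qed.

Lemma second_derivative_wrt_ext (D : R -> Prop) (x f f' g g' : R -> R) :
  (forall l, D l -> f' l = f l) -> (forall l, D l -> g l = g' l) ->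
  second_derivative_wrt D x f g -> second_derivative_wrt D x f' g'.
Proof.
  intros Hf Hg H F HF. destruct (H F) as [F1 HF1].
  - intros l Hl. rewrite HF by exact Hl. auto.
  - exists F1. intros l Hl. rewrite <- Hg by exact Hl. auto.
Qed.

(* The Wronskian [w1 v - w v1] is [-k] times the derivative of [w / v] with
   respect to [x], and its own derivative is [q w v]. *)
Lemma reduced_second_derivative (D : R -> Prop) (k : R) (w w1 v v1 h q x : R -> R) :
  k <> 0 ->
  (forall l, D l -> locally l D) ->
  (forall l, D l -> is_derive w l (w1 l) /\ is_derive w1 l ((h l + q l) * w l)) ->
  (forall l, D l -> is_derive v l (v1 l) /\ is_derive v1 l (h l * v l)) ->
  (forall l, D l -> v l <> 0) ->
  (forall l, D l -> is_derive x l (- k / v l ^ 2)) ->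
  second_derivative_wrt D x (fun l => w l / v l)
    (fun l => v l ^ 4 / k ^ 2 * q l * (w l / v l)).
Proof.
  intros Hk HD Hw Hv Hv0 Hx F HF.
  assert (Hxc : forall l, D l -> - k / v l ^ 2 <> 0).
  { intros l Hl. specialize (Hv0 l Hl). apply Rmult_integral_contrapositive_currified.
    - lra.
    - apply Rinv_neq_0_compat. apply pow_nonzero. exact Hv0. }
  assert (HF1 : forall l, D l -> is_derive F (x l) (- (w1 l * v l - w l * v1 l) / k)).
  { intros l Hl. destruct (Hw l Hl) as [Hwl _]. destruct (Hv l Hl) as [Hvl _].
    replace (- (w1 l * v l - w l * v1 l) / k)
      with ((w1 l * v l - w l * v1 l) / v l ^ 2 / (- k / v l ^ 2)) by (field; auto).
    apply is_derive_wrt with (fun s => w s / v s).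
    - generalize (HD l Hl). apply filter_imp. intros s Hs. split; [| apply HF; exact Hs].
      apply (is_derive_continuous x s _ (Hx s Hs)).
    - apply Hx; exact Hl.
    - apply Hxc; exact Hl.
    - apply is_derive_div; auto. }
  (* As a function of the new variable the first derivative is [Derive F]. By [HF1] it equals the
     Wronskian over [- k] along [D], so [is_derive_wrt] applies a second time with [Derive F] in the
     role of [F]. *)
  exists (Derive F). intros l Hl. split.
  - apply Derive_correct. eexists. apply HF1; exact Hl.
  - destruct (Hw l Hl) as [Hwl Hwl1]. destruct (Hv l Hl) as [Hvl Hvl1].
    replace (v l ^ 4 / k ^ 2 * q l * (w l / v l))
      with (- (((h l + q l) * w l * v l + w1 l * v1 l) - (w1 l * v1 l + w l * (h l * v l))) / k
            / (- k / v l ^ 2)) by (field; auto).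
    apply is_derive_wrt with (fun s => - (w1 s * v s - w s * v1 s) / k).
    + generalize (HD l Hl). apply filter_imp. intros s Hs. split.
      * apply (is_derive_continuous x s _ (Hx s Hs)).
      * apply is_derive_unique. apply HF1; exact Hs.
    + apply Hx; exact Hl.
    + apply Hxc; exact Hl.
    + unfold Rdiv. rewrite (Rmult_comm _ (/ k)).
      apply is_derive_ext with (fun s => / k * - (w1 s * v s - w s * v1 s));
        [intros s; apply Rmult_comm |].
      apply (is_derive_scal (fun s => - (w1 s * v s - w s * v1 s))).
      apply (@is_derive_opp R_AbsRing R_NormedModule (fun s => w1 s * v s - w s * v1 s)).
      apply (@is_derive_minus R_AbsRing R_NormedModule (fun s => w1 s * v s) (fun s => w s * v1 s));
        apply is_derive_Rmult; assumption.
Qed.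

(** * Tail integrals as functions of the lower limit, the upper end being a filter [G]:
    [at_left lmax] in (i), infinity in (ii) *)

Section Tail.

Variables (G : (R -> Prop) -> Prop) (f X : R -> R).
Context {FG : ProperFilter G}.

Lemma tail_integral_Chasles (l m : R) :
  ex_RInt f l m ->
  is_RInt_gen f (at_point l) G (X l) -> is_RInt_gen f (at_point m) G (X m) ->
  X l = RInt f l m + X m.
Proof.
  intros Hf Hl Hm.
  assert (H : is_RInt_gen f (at_point l) G (plus (RInt f l m) (X m))).
  { apply (is_RInt_gen_Chasles f m); [| exact Hm].
    apply is_RInt_gen_at_point. apply (RInt_correct f). exact Hf. }
  rewrite <- (is_RInt_gen_unique f _ Hl). exact (is_RInt_gen_unique f _ H).
Qed.

Lemma tail_integral_decr (l m : R) :
  l < m -> (forall s, l <= s <= m -> continuous f s /\ 0 < f s) ->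
  is_RInt_gen f (at_point l) G (X l) -> is_RInt_gen f (at_point m) G (X m) ->
  X m < X l.
Proof.
  intros Hlm Hf Hl Hm. rewrite (tail_integral_Chasles l m); auto.
  - assert (0 < RInt f l m); [| lra].
    apply RInt_gt_0; [exact Hlm | |]; intros s Hs; apply Hf; lra.
  - apply (ex_RInt_continuous f). intros s. rewrite Rmin_left, Rmax_right by lra. intros Hs. apply Hf; exact Hs.
Qed.

Lemma is_derive_tail_integral (l : R) :
  locally l (fun s => continuous f s /\ is_RInt_gen f (at_point s) G (X s)) ->
  is_derive X l (- f l).
Proof.
  intros Hloc. apply locally_R in Hloc. destruct Hloc as [d [Hd Hloc]].
  assert (Hl : continuous f l /\ is_RInt_gen f (at_point l) G (X l)).
  { apply Hloc. rewrite Rminus_diag, Rabs_R0. exact Hd. }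
  assert (Hex : forall s, Rabs (s - l) < d -> ex_RInt f l s).
  { intros s Hs. apply (ex_RInt_continuous f). intros t Ht. apply Hloc.
    apply Rabs_def2 in Hs. unfold Rmin, Rmax in Ht. destruct (Rle_dec l s); apply Rabs_def1; lra. }
  apply is_derive_ext_loc with (fun s => X l - RInt f l s).
  - apply locally_R. exists d. split; [exact Hd |]. intros s Hs.
    rewrite (tail_integral_Chasles l s); [exact (Rplus_minus_l _ _) | auto | apply Hl | apply Hloc; exact Hs].
  - replace (- f l) with (0 - f l) by ring.
    apply (@is_derive_minus R_AbsRing R_NormedModule (fun _ => X l) (fun s => RInt f l s)).
    + apply (@is_derive_const R_AbsRing R_NormedModule).
    + apply (is_derive_RInt f (fun s => RInt f l s) l l); [| apply Hl].
      apply locally_R. exists d. split; [exact Hd |]. intros s Hs.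
      apply (RInt_correct f). apply Hex. exact Hs.
Qed.

End Tail.

(** The partial integrals of a nonnegative function increase with the upper limit, so they converge
    to their supremum [L]. *)
Lemma ex_RInt_gen_bounded (f : R -> R) (s M : R) :
  (forall t, s <= t -> continuous f t /\ 0 <= f t) ->
  (forall Z, s <= Z -> RInt f s Z <= M) ->
  ex_RInt_gen f (at_point s) (Rbar_locally p_infty).
Proof.
  intros Hf HM.
  assert (Hex : forall a b, s <= a <= b -> ex_RInt f a b).
  { intros a b Hab. apply (ex_RInt_continuous f). intros t. rewrite Rmin_left, Rmax_right by lra.
    intros Ht. apply Hf. lra. }
  destruct (completeness (fun y => exists Z, s <= Z /\ y = RInt f s Z)) as [L [HLub HLleast]].
  - exists M. intros y [Z [HZ ->]]. auto.
  - exists (RInt f s s), s. split; [lra | reflexivity].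
  - exists L. intros P [eps HP].
    assert (HZ0 : exists Z0, s <= Z0 /\ L - eps < RInt f s Z0).
    { apply Classical_Prop.NNPP. intros Hn.
      assert (L <= L - eps); [| pose proof (cond_pos eps); lra].
      apply HLleast. intros y [Z [HZ ->]]. apply Rnot_lt_le. intros Hlt. apply Hn. eauto. }
    destruct HZ0 as [Z0 [HZ0 HL]].
    apply Filter_prod with (Q := fun t => t = s) (R := fun t => Z0 < t).
    + reflexivity.
    + exists Z0. auto.
    + intros a b -> Hb. exists (RInt f s b). split; [apply (RInt_correct f), Hex; simpl; lra |].
      apply HP. apply R_ball.
      assert (RInt f s b <= L) by (apply HLub; exists b; split; [lra | reflexivity]).
      assert (Hch : RInt f s b = RInt f s Z0 + RInt f Z0 b).
      { symmetry. apply (RInt_Chasles f); apply Hex; lra. }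
      assert (0 <= RInt f Z0 b).
      { apply RInt_ge_0; [lra | apply Hex; lra |]. intros t Ht. apply Hf. lra. }
      pose proof (cond_pos eps). apply Rabs_def1; lra.
Qed.

(** * Limits at the vertex *)

Lemma vertex_domain_filter (D : R -> Prop) (P : R -> Prop) :
  vertex_domain D -> D 0 ->
  within D (locally 0) P -> at_right 0 P.
Proof.
  intros HD H0 HP. destruct (HD 0 H0) as [_ [l' [Hl' Hm]]].
  apply locally_R in HP. destruct HP as [d [Hd HP]].
  apply locally_R. exists (Rmin d l'). split; [apply Rmin_pos; assumption |].
  intros y Hy Hpos. pose proof (Rmin_l d l'). pose proof (Rmin_r d l').
  apply HP; [lra |]. apply Hm. apply Rabs_def2 in Hy. lra.
Qed.

(** Since [f 0 = 0], this is the difference quotient at the vertex. It turns w / v into a quotient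
    of two quantities that both tend to 1, and bounds w and v by multiples of l. *)
Lemma vertex_ratio (D : R -> Prop) (f f1 : R -> R) :
  vertex_domain D -> D 0 -> D_in f f1 D 0 -> f 0 = 0 ->
  filterlim (fun l => f l / l) (at_right 0) (locally (f1 0)).
Proof.
  intros HD H0 Hf Hf0. apply filterlim_locally. intros eps.
  destruct (Hf eps (cond_pos eps)) as [alp [Ha H]].
  assert (Hw : at_right 0 (fun l => D l /\ Rabs (l - 0) < alp)).
  { apply (vertex_domain_filter D); auto. apply locally_R. exists alp. auto. }
  assert (Hp : at_right 0 (fun l => 0 < l)) by (apply locally_R; exists 1; split; [lra | auto]).
  generalize (filter_and _ _ Hw Hp). apply filter_imp. intros l [[Hl Hla] Hl0].
  apply R_ball. specialize (H l). simpl in H. unfold Rdist in H.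
  rewrite Hf0, !Rminus_0_r in H. rewrite Rminus_0_r in Hla. apply H.
  repeat split; [exact Hl | lra | exact Hla].
Qed.

(** * The quotient of two vertex solutions *)

Section VertexIVP.

Variables (D : R -> Prop) (h q w w1 v v1 : R -> R).
Hypotheses (HD : vertex_domain D) (H0 : D 0).
Hypothesis Hq : continuous_on D q.
Hypothesis Hw : vertex_ivp D (fun l => h l + q l) w w1.
Hypothesis Hv : vertex_ivp D h v v1.
Hypothesis Hpos : forall l, D l -> 0 < l -> 0 < v l.

Lemma vertex_quotient_lim : filterlim (fun l => w l / v l) (at_right 0) (locally 1).
Proof.
  destruct Hw as [Hw0 [Hw10 Hwd]]. destruct Hv as [Hv0 [Hv10 Hvd]].
  assert (Hp : at_right 0 (fun l => 0 < l)) by (apply locally_R; exists 1; split; [lra | auto]).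
  assert (HDr : at_right 0 D).
  { apply (vertex_domain_filter D); auto. apply locally_R. exists 1. split; [lra | auto]. }
  apply filterlim_ext_loc with (fun l => mult (w l / l) (/ (v l / l))).
  - generalize (filter_and _ _ Hp HDr). apply filter_imp. intros l [Hl HDl].
    unfold mult; simpl. field. specialize (Hpos l HDl Hl). lra.
  - replace 1 with (mult 1 (/ 1)) by (unfold mult; simpl; field).
    apply (@filterlim_comp_2 _ _ _ _ _ (locally 1) (locally (/ 1)) (locally (mult 1 (/ 1)))); [apply _ | | |].
    + rewrite <- Hw10. apply (vertex_ratio D); auto. apply Hwd; exact H0.
    + apply (filterlim_comp _ _ _ (fun l => v l / l) Rinv _ (locally 1)).
      * rewrite <- Hv10. apply (vertex_ratio D); auto. apply Hvd; exact H0.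
      * apply continuous_Rinv. lra.
    + apply (@filterlim_mult R_AbsRing).
Qed.

Lemma is_derive_vertex_quotient (l : R) :
  D l -> 0 < l ->
  is_derive (fun l => w l / v l) l ((w1 l * v l - w l * v1 l) / v l ^ 2).
Proof.
  intros Hl Hl0. destruct Hw as [_ [_ Hwd]]. destruct Hv as [_ [_ Hvd]].
  specialize (Hpos l Hl Hl0).
  apply is_derive_div; [| | lra]; apply (vertex_domain_is_derive D); auto;
    [apply Hwd | apply Hvd]; exact Hl.
Qed.

(* The Wronskian vanishes at the vertex and has derivative [q w v = O(l^2)],
   so it is [O(l^3)], whereas [v^2] is of order [l^2]. *)
Lemma vertex_quotient_derive_lim :
  filterlim (Derive (fun l => w l / v l)) (at_right 0) (locally 0).
Proof.
  destruct Hw as [Hw0 [Hw10 Hwd]]. destruct Hv as [Hv0 [Hv10 Hvd]].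
  assert (Hp : at_right 0 (fun l => 0 < l)) by (apply locally_R; exists 1; split; [lra | auto]).
  assert (HDr : at_right 0 D).
  { apply (vertex_domain_filter D); auto. apply locally_R. exists 1. split; [lra | auto]. }
  assert (Hbw : at_right 0 (fun l => Rabs (w l / l - 1) < 1)).
  { pose proof (vertex_ratio D w w1 HD H0 (proj1 (Hwd 0 H0)) Hw0) as H.
    rewrite Hw10 in H. apply filterlim_locally with (eps := mkposreal 1 Rlt_0_1) in H. exact H. }
  assert (Hbv : at_right 0 (fun l => Rabs (v l / l - 1) < / 2)).
  { pose proof (vertex_ratio D v v1 HD H0 (proj1 (Hvd 0 H0)) Hv0) as H.
    rewrite Hv10 in H.
    apply filterlim_locally with (eps := mkposreal (/ 2) ltac:(lra)) in H. exact H. }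
  assert (Hbq : at_right 0 (fun l => Rabs (q l - q 0) < 1)).
  { apply (vertex_domain_filter D); auto.
    destruct (filterlim_within_locally q D 0 1 (Hq 0 H0) Rlt_0_1) as [d [Hd H]].
    apply locally_R. exists d. auto. }
  set (Q := Rabs (q 0) + 1).
  assert (HQ : 0 < Q) by (unfold Q; pose proof (Rabs_pos (q 0)); lra).
  assert (Hbnd : at_right 0 (fun l => D l /\ Rabs (w l) <= 2 * l /\ l / 2 <= v l <= 2 * l /\ Rabs (q l) <= Q)).
  { generalize (filter_and _ _ (filter_and _ _ Hp HDr) (filter_and _ _ Hbw (filter_and _ _ Hbv Hbq))).
    apply filter_imp. intros l [[Hl HDl] [Hwl [Hvl Hql]]].
    assert (Ew : w l = w l / l * l) by (field; lra).
    assert (Ev : v l = v l / l * l) by (field; lra).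
    apply Rabs_def2 in Hwl. apply Rabs_def2 in Hvl.
    repeat split.
    - exact HDl.
    - apply Rabs_le. nra.
    - nra.
    - nra.
    - unfold Q. replace (q l) with (q l - q 0 + q 0) by ring.
      eapply Rle_trans; [apply Rabs_triang | lra]. }
  apply locally_R in Hbnd. destruct Hbnd as [d [Hd Hbnd]].
  set (N := fun l => w1 l * v l - w l * v1 l).
  assert (HN : forall l, D l -> D_in N (fun l => q l * w l * v l) D l).
  { intros l Hl. destruct (Hwd l Hl) as [A1 A2]. destruct (Hvd l Hl) as [B1 B2].
    eapply D_in_change; [| apply Dminus; apply Dmult; eassumption]. cbv beta. ring. }
  assert (HN0 : N 0 = 0) by (unfold N; rewrite Hw0, Hv0; ring).
  (* The mean value theorem gives |N l| <= Q (2 l) (2 l) l, and v^2 >= l^2 / 4; the quotient of the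
     two bounds is 16 Q l. *)
  assert (Hest : forall l, 0 < l < d -> Rabs (Derive (fun l => w l / v l) l) <= 16 * Q * l).
  { intros l Hl.
    destruct (Hbnd l) as [HDl [_ [Hvl _]]]; [rewrite Rabs_pos_eq; lra | lra |].
    replace (Derive (fun l => w l / v l) l) with (N l / v l ^ 2)
      by (symmetry; apply is_derive_unique, is_derive_vertex_quotient; [exact HDl | lra]).
    destruct (vertex_MVT D N (fun l => q l * w l * v l) 0 l HD HN) as [m [Hm He]]; [lra | exact HDl |].
    rewrite HN0, !Rminus_0_r in He. rewrite He.
    destruct (Hbnd m) as [_ [Hwm [Hvm Hqm]]]; [rewrite Rabs_pos_eq; lra | lra |].
    assert (Hprod : Rabs (q m * w m * v m * l) <= Q * (2 * l) * (2 * l) * l).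
    { rewrite !Rabs_mult, (Rabs_pos_eq (v m)), (Rabs_pos_eq l) by lra.
      apply Rmult_le_compat_r; [lra |].
      apply Rmult_le_compat; [apply Rmult_le_pos; apply Rabs_pos | lra | | lra].
      apply Rmult_le_compat; try apply Rabs_pos; lra. }
    unfold Rdiv. rewrite Rabs_mult, (Rabs_pos_eq (/ v l ^ 2))
      by (left; apply Rinv_0_lt_compat; apply pow_lt; lra).
    apply Rmult_le_reg_r with (v l ^ 2); [apply pow_lt; lra |].
    rewrite Rmult_assoc, Rinv_l, Rmult_1_r by (apply pow_nonzero; lra).
    assert (l ^ 2 / 4 <= v l ^ 2) by nra.
    assert (0 <= 16 * Q * l) by nra.
    apply Rle_trans with (16 * Q * l * (l ^ 2 / 4)); [lra |].
    apply Rmult_le_compat_l; assumption. }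
  apply filterlim_locally. intros eps. apply locally_R.
  pose proof (cond_pos eps) as Heps.
  assert (He : 0 < eps / (16 * Q)) by (apply Rdiv_lt_0_compat; lra).
  exists (Rmin d (eps / (16 * Q))). split; [apply Rmin_pos; assumption |].
  intros l Hl Hl0. apply R_ball. rewrite Rminus_0_r in *.
  rewrite (Rabs_pos_eq l) in Hl by lra.
  pose proof (Rmin_l d (eps / (16 * Q))). pose proof (Rmin_r d (eps / (16 * Q))).
  eapply Rle_lt_trans; [apply Hest; lra |].
  replace (pos eps) with (16 * Q * (eps / (16 * Q))) by (field; lra).
  apply Rmult_lt_compat_l; lra.
Qed.

End VertexIVP.

Lemma relative_focusing (lmax : R) (h q w w1 v v1 X : R -> R) :
  let I0 := fun l : R => 0 <= l < lmax in
  let I := fun l : R => 0 < l < lmax in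
  0 < lmax ->
  continuous_on I0 q ->
  vertex_ivp I0 (fun l => h l + q l) w w1 ->
  vertex_ivp I0 h v v1 ->
  (forall l, I l -> 0 < v l) ->
  (forall l, I l ->
    is_RInt_gen (fun s => / v s ^ 2) (at_point l) (at_left lmax) (X l)) ->
  let a := fun l : R => w l / v l in
  (forall l l', I l -> I l' -> l < l' -> X l' < X l) /\
  second_derivative_wrt I X a (fun l => v l ^ 4 * q l * a l) /\
  filterlim a (at_right 0) (locally 1) /\
  (forall l, I l -> ex_derive a l) /\
  filterlim (Derive a) (at_right 0) (locally 0).
Proof.
  intros I0 I Hlmax Hq Hw Hv Hpos HX a.
  assert (HD : vertex_domain I0).
  { intros l Hl. split; [apply Hl |]. exists lmax. split; [apply Hl | auto]. }
  assert (H0 : I0 0) by (split; lra).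
  assert (Hpos0 : forall l, I0 l -> 0 < l -> 0 < v l) by (intros l [_ Hl] Hl0; apply Hpos; split; assumption).
  assert (HI : forall l, I l -> I0 l /\ 0 < l) by (intros l [Hl Hl']; repeat split; lra).
  assert (Hder : forall f f1 l, I l -> D_in f f1 I0 l -> is_derive f l (f1 l)).
  { intros f f1 l Hl. apply (vertex_domain_is_derive I0); [exact HD | |]; apply HI; exact Hl. }
  assert (Hc : forall l, I l -> continuous (fun s => / v s ^ 2) l /\ 0 < / v l ^ 2).
  { intros l Hl. pose proof (Hpos l Hl) as Hvl. split.
    - apply continuous_comp with (g := Rinv).
      + apply (is_derive_continuous _ l (2 * v1 l * v l)).
        assert (is_derive v l (v1 l)) by (apply Hder; [exact Hl | apply Hv, HI; exact Hl]).
        apply is_derive_ext with (fun s => v s * v s); [intros s; simpl; ring |].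
        replace (2 * v1 l * v l) with (v1 l * v l + v l * v1 l) by ring.
        apply is_derive_Rmult; exact H.
      + apply continuous_Rinv. apply pow_nonzero. lra.
    - apply Rinv_0_lt_compat, pow_lt. exact Hvl. }
  assert (HIo : forall l, I l -> locally l I) by (intros l Hl; apply locally_open_interval; exact Hl).
  split; [| split; [| split; [| split]]].
  - intros l l' Hl Hl' Hll.
    apply (@tail_integral_decr (at_left lmax) (fun s => / v s ^ 2) X _); auto.
    intros s Hs. apply Hc. unfold I in *. lra.
  - apply (second_derivative_wrt_ext I X a a (fun l => v l ^ 4 / 1 ^ 2 * q l * a l)).
    + intros l Hl. reflexivity.
    + intros l Hl. field.
    + apply (reduced_second_derivative I 1 w w1 v v1 h q X); try exact HIo.
      * lra.
      * intros l Hl. destruct Hw as [_ [_ Hwd]]. destruct (Hwd l) as [A1 A2]; [apply HI; exact Hl |].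
        split; [apply Hder; auto | exact (Hder _ _ l Hl A2)].
      * intros l Hl. destruct Hv as [_ [_ Hvd]]. destruct (Hvd l) as [A1 A2]; [apply HI; exact Hl |].
        split; [apply Hder; auto | exact (Hder _ _ l Hl A2)].
      * intros l Hl. specialize (Hpos l Hl). lra.
      * intros l Hl. replace (- (1) / v l ^ 2) with (- / v l ^ 2) by (field; specialize (Hpos l Hl); lra).
        apply (@is_derive_tail_integral (at_left lmax) (fun s => / v s ^ 2) X _).
        generalize (HIo l Hl). apply filter_imp. intros s Hs. split; [apply Hc | apply HX]; exact Hs.
  - apply (vertex_quotient_lim I0 h q w w1 v v1); assumption.
  - intros l Hl. eexists. apply (is_derive_vertex_quotient I0 h q w w1 v v1); auto; apply HI; exact Hl.
  - apply (vertex_quotient_derive_lim I0 h q w w1 v v1); assumption.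
Qed.

(** * Sturm comparison *)

Lemma D_in_subset (D D' : R -> Prop) (f d : R -> R) (x : R) :
  (forall s, D' s -> D s) -> D_in f d D x -> D_in f d D' x.
Proof.
  intros H Hf eps He. destruct (Hf eps He) as [alp [Ha Hal]]. exists alp. split; [exact Ha |].
  intros y [[Hy Hne] Hd]. apply Hal. repeat split; auto.
Qed.

Section Sturm.

(** The systems are v'' = g v and u'' = p u after a change of variable: [m] is the derivative of the
    old variable with respect to the new one, and [v1], [u1] remain derivatives with respect to the
    old one. *)
Variables (D : R -> Prop) (m g p v v1 u u1 : R -> R).
Hypotheses (HD : vertex_domain D) (H0 : D 0).
Hypothesis Hm : forall l, D l -> 0 < m l.
Hypothesis Hv : forall l, D l -> D_in v (fun s => m s * v1 s) D l.
Hypothesis Hv1 : forall l, D l -> D_in v1 (fun s => m s * (g s * v s)) D l.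
Hypothesis Hu : forall l, D l -> D_in u (fun s => m s * u1 s) D l.
Hypothesis Hu1 : forall l, D l -> D_in u1 (fun s => m s * (p s * u s)) D l.
Hypothesis Hupos : forall l, D l -> 0 < u l.
Hypothesis Hpg : forall l, D l -> p l <= g l.
Hypotheses (Hv0 : v 0 = 0) (Hv10 : 0 < v1 0).

Let W l := v1 l * u l - v l * u1 l.

Lemma sturm_wronskian_initial_pos : 0 < W 0.
Proof. unfold W. rewrite Hv0. pose proof (Hupos 0 H0). nra. Qed.

(** W' = m (g - p) v u, and every factor is nonnegative as long as v is positive. *)
Lemma sturm_wronskian_incr (t : R) :
  D t -> 0 < t -> (forall s, 0 < s < t -> 0 < v s) -> W 0 <= W t.
Proof.
  intros Ht Ht0 Hpos.
  destruct (vertex_MVT D W (fun l => m l * ((g l - p l) * (v l * u l))) 0 t HD) as [c [Hc He]].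
  - intros l Hl. eapply D_in_change; [| apply Dminus; apply Dmult; auto]. cbv beta. ring.
  - lra.
  - exact Ht.
  - assert (Hcd : D c) by (apply (vertex_domain_between D t); auto; lra).
    pose proof (Hm c Hcd). pose proof (Hupos c Hcd). pose proof (Hpg c Hcd). specialize (Hpos c Hc).
    assert (0 <= m c * ((g c - p c) * (v c * u c)) * (t - 0)); [| lra].
    repeat apply Rmult_le_pos; lra.
Qed.

Lemma sturm_is_derive (l : R) :
  D l -> 0 < l -> is_derive v l (m l * v1 l) /\ is_derive u l (m l * u1 l).
Proof.
  intros Hl Hl0.
  split; [apply (vertex_domain_is_derive D v (fun s => m s * v1 s))
         | apply (vertex_domain_is_derive D u (fun s => m s * u1 s))]; auto.
Qed.

(* As long as [v > 0], the quotient [v / u] is increasing, so [v] cannot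
   return to 0. *)
Lemma sturm_pos_closed (t : R) :
  D t -> 0 < t -> (forall s, 0 < s < t -> 0 < v s) -> 0 < v t.
Proof.
  intros Ht Ht0 Hpos.
  assert (HDc : forall c, 0 < c <= t -> D c) by (intros c Hc; apply (vertex_domain_between D t); auto; lra).
  assert (Hd : forall c, 0 < c <= t -> is_derive (fun s => v s / u s) c (m c * W c / u c ^ 2)).
  { intros c Hc. destruct (sturm_is_derive c) as [A1 A2]; [apply HDc; exact Hc | lra |].
    pose proof (Hupos c (HDc c Hc)).
    replace (m c * W c / u c ^ 2) with ((m c * v1 c * u c - v c * (m c * u1 c)) / u c ^ 2)
      by (unfold W; field; lra).
    apply is_derive_div; auto. lra. }
  (* The comparison starts from t / 2, where v / u is already positive and derivatives are
     two-sided. *)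
  destruct (MVT_is_derive (fun s => v s / u s) (fun c => m c * W c / u c ^ 2) (t / 2) t) as [c [Hc He]].
  - lra.
  - intros c Hc. apply Hd. lra.
  - intros c Hc. apply continuity_pt_filterlim. exact (is_derive_continuous (fun s => v s / u s) c _ (Hd c ltac:(lra))).
  - assert (HWc : W 0 <= W c).
    { apply sturm_wronskian_incr; [apply HDc; lra | lra |]. intros s Hs. apply Hpos. lra. }
    pose proof sturm_wronskian_initial_pos.
    pose proof (Hm c (HDc c ltac:(lra))). pose proof (Hupos c (HDc c ltac:(lra))).
    pose proof (Hupos t Ht). pose proof (Hupos (t / 2) (HDc (t / 2) ltac:(lra))).
    pose proof (Hpos (t / 2) ltac:(lra)).
    assert (0 < m c * W c / u c ^ 2 * (t - t / 2)).
    { apply Rmult_lt_0_compat; [| lra]. apply Rdiv_lt_0_compat; [nra | apply pow_lt; assumption]. }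
    assert (0 < v (t / 2) / u (t / 2)) by (apply Rdiv_lt_0_compat; assumption).
    replace (v t) with (v t / u t * u t) by (field; lra).
    apply Rmult_lt_0_compat; lra.
Qed.

(** v has the positive slope [m 0 * v1 0] at the vertex. This starts the continuation argument. *)
Lemma sturm_pos_near_vertex : exists d, 0 < d /\ forall s, 0 < s < d -> 0 < v s.
Proof.
  pose proof (vertex_ratio D v (fun s => m s * v1 s) HD H0 (Hv 0 H0) Hv0) as H. cbv beta in H.
  assert (He : 0 < m 0 * v1 0) by (pose proof (Hm 0 H0); nra).
  apply filterlim_locally with (eps := mkposreal _ He) in H. apply locally_R in H.
  destruct H as [d [Hd H]]. exists d. split; [exact Hd |]. intros s Hs.
  assert (Hs' : Rabs (s - 0) < d) by (rewrite Rminus_0_r, Rabs_pos_eq; lra).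
  assert (Hb : Rabs (v s / s - m 0 * v1 0) < m 0 * v1 0) by exact (H s Hs' (proj1 Hs)).
  apply Rabs_def2 in Hb.
  replace (v s) with (v s / s * s) by (field; lra). apply Rmult_lt_0_compat; lra.
Qed.

(** Continuation: let t be the supremum of the points up to which v is positive. Then v is positive
    at t by [sturm_pos_closed], and beyond t by continuity, so t cannot lie before l. *)
Lemma sturm_pos (l : R) : D l -> 0 < l -> 0 < v l.
Proof.
  intros Hl Hl0. apply Rnot_le_lt. intros Hle.
  set (E := fun s => 0 <= s <= l /\ forall t, 0 < t <= s -> 0 < v t).
  destruct sturm_pos_near_vertex as [d [Hd Hnear]].
  destruct (completeness E) as [t [Hub Hleast]].
  - exists l. intros s [Hs _]. lra.
  - exists 0. split; [lra |]. intros t Ht. lra.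
  - assert (Hdl : 0 < Rmin (d / 2) l <= t).
    { split; [apply Rmin_pos; lra |]. apply Hub. pose proof (Rmin_l (d / 2) l). pose proof (Rmin_r (d / 2) l).
      split; [split; [left; apply Rmin_pos; lra | lra] |]. intros s Hs. apply Hnear. lra. }
    assert (Htl : t <= l) by (apply Hleast; intros s [Hs _]; lra).
    assert (Hbelow : forall s, 0 < s < t -> 0 < v s).
    { intros s Hs. apply Classical_Prop.NNPP. intros Hn. assert (t <= s); [| lra].
      apply Hleast. intros e [He1 He2]. apply Rnot_lt_le. intros Hse. apply Hn, He2. lra. }
    assert (HDt : D t) by (apply (vertex_domain_between D l); auto; lra).
    pose proof (sturm_pos_closed t HDt ltac:(lra) Hbelow) as Hvt.
    destruct (Req_dec t l) as [-> | Hne]; [lra |].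
    destruct (filterlim_within_locally v D t (v t) (D_in_continuous_within _ _ _ _ (Hv t HDt)) Hvt)
      as [e [He Hcont]].
    assert (t + Rmin (e / 2) (l - t) <= t); [| assert (0 < Rmin (e / 2) (l - t)) by (apply Rmin_pos; lra); lra].
    apply Hub. pose proof (Rmin_l (e / 2) (l - t)). pose proof (Rmin_r (e / 2) (l - t)).
    assert (0 < Rmin (e / 2) (l - t)) by (apply Rmin_pos; lra).
    split; [lra |]. intros s Hs. destruct (Rlt_le_dec s t) as [Hst | Hst]; [apply Hbelow; lra |].
    specialize (Hcont s). rewrite Rabs_pos_eq in Hcont by lra.
    specialize (Hcont ltac:(lra)). apply Rabs_def2 in Hcont; [lra |].
    apply (vertex_domain_between D l); auto; lra.
Qed.

(* Since [(u / v)' = - m W / v^2] with [W >= W 0], the integrand [m / v^2] is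
   dominated by the derivative of [- u / (W 0 v)]. *)
Lemma sturm_tail_bound (f : R -> R) (K s Z : R) :
  (forall l, D l -> 0 < l -> continuous f l /\ f l <= K * m l / v l ^ 2) -> 0 <= K ->
  0 < s <= Z -> D Z ->
  RInt f s Z <= K * u s / (v1 0 * u 0 * v s).
Proof.
  intros Hf HK HsZ HZ.
  assert (HDc : forall c, 0 < c <= Z -> D c) by (intros c Hc; apply (vertex_domain_between D Z); auto; lra).
  assert (HW0 : W 0 = v1 0 * u 0) by (unfold W; rewrite Hv0; ring).
  pose proof sturm_wronskian_initial_pos as HW0pos.
  assert (Hub : forall c, 0 < c <= Z -> 0 < K * u c / (W 0 * v c) \/ K = 0).
  { intros c Hc. destruct HK as [HK | HK]; [left | right; auto].
    apply Rdiv_lt_0_compat; apply Rmult_lt_0_compat; auto; try (apply sturm_pos; [auto | lra]). }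
  assert (Hub0 : forall c, 0 < c <= Z -> 0 <= K * u c / (W 0 * v c)).
  { intros c Hc. destruct (Hub c Hc) as [H | ->]; [lra |]. unfold Rdiv. rewrite !Rmult_0_l. lra. }
  rewrite <- HW0.
  destruct (Req_dec s Z) as [-> | Hne].
  { rewrite (RInt_point Z f). apply Hub0. lra. }
  (* [H] is nonincreasing because W >= W 0. At [s] it equals the claimed bound, and at [Z] it
     exceeds the partial integral by a nonnegative term. *)
  set (H := fun z => RInt f s z + K * u z / (W 0 * v z)).
  assert (Hd : forall z, s <= z <= Z -> is_derive H z (f z - K * m z * W z / (W 0 * v z ^ 2))).
  { intros z Hz. assert (HDz : D z) by (apply HDc; lra).
    destruct (sturm_is_derive z HDz ltac:(lra)) as [A1 A2].
    pose proof (sturm_pos z HDz ltac:(lra)) as Hvz.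
    replace (f z - K * m z * W z / (W 0 * v z ^ 2))
      with (f z + (K * (m z * u1 z) * (W 0 * v z) - K * u z * (W 0 * (m z * v1 z))) / (W 0 * v z) ^ 2)
      by (unfold W at 4; field; lra).
    apply (@is_derive_plus R_AbsRing R_NormedModule (fun z => RInt f s z) (fun z => K * u z / (W 0 * v z))).
    - apply (is_derive_RInt f (fun z => RInt f s z) s z); [| apply Hf; [exact HDz | lra]].
      generalize (vertex_domain_locally D z HD HDz ltac:(lra)). intros Hloc.
      assert (Hpos : locally z (fun y => 0 < y < z + 1)) by (apply locally_open_interval; lra).
      generalize (filter_and _ _ Hloc Hpos). apply filter_imp. intros y [HDy Hy].
      apply (RInt_correct f). apply (ex_RInt_continuous f). intros t Ht.
      unfold Rmin, Rmax in Ht. destruct (Rle_dec s y); apply Hf; try lra.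
      + apply (vertex_domain_between D y); auto; lra.
      + apply HDc; lra.
    - apply (is_derive_div (fun z => K * u z) (fun z => W 0 * v z) z).
      + exact (is_derive_scal u z K _ A2).
      + exact (is_derive_scal v z (W 0) _ A1).
      + apply Rgt_not_eq, Rmult_lt_0_compat; auto. }
  destruct (MVT_is_derive H (fun z => f z - K * m z * W z / (W 0 * v z ^ 2)) s Z) as [c [Hc He]].
  - lra.
  - intros c Hc. apply Hd. lra.
  - intros c Hc. apply continuity_pt_filterlim. exact (is_derive_continuous H c _ (Hd c Hc)).
  - assert (HDcc : D c) by (apply HDc; lra).
    pose proof (sturm_pos c HDcc ltac:(lra)) as Hvc. pose proof (Hm c HDcc).
    assert (HWc : W 0 <= W c).
    { apply sturm_wronskian_incr; [exact HDcc | lra |]. intros t Ht. apply sturm_pos; [apply HDc; lra | lra]. }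
    destruct (Hf c HDcc ltac:(lra)) as [_ Hfc].
    assert (K * m c / v c ^ 2 <= K * m c * W c / (W 0 * v c ^ 2)).
    { replace (K * m c * W c / (W 0 * v c ^ 2)) with (K * m c / v c ^ 2 * (W c / W 0)) by (field; lra).
      rewrite <- (Rmult_1_r (K * m c / v c ^ 2)) at 1. apply Rmult_le_compat_l.
      - apply Rmult_le_pos; [nra |]. left. apply Rinv_0_lt_compat, pow_lt. exact Hvc.
      - apply Rmult_le_reg_r with (W 0); [lra |]. unfold Rdiv. rewrite Rmult_assoc, Rinv_l; lra. }
    assert (Hle : H Z <= H s) by nra.
    unfold H in Hle. rewrite RInt_point in Hle. pose proof (Hub0 Z ltac:(lra)).
    change (@zero R_CompleteNormedModule) with 0 in Hle. lra.
Qed.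

End Sturm.

(** * The Jacobi map *)

Lemma entry_Mmult (A B : matrix 2 2) (i j : nat) :
  (i < 2)%nat -> (j < 2)%nat ->
  entry (Mmult (T := R_Ring) A B) i j = entry A i 0 * entry B 0 j + entry A i 1 * entry B 1 j.
Proof.
  intros Hi Hj. unfold entry, Mmult. rewrite coeff_mat_bij by assumption.
  simpl pred. rewrite sum_Sn, sum_O. reflexivity.
Qed.

Lemma det2_scale2 (k : R) (M : matrix 2 2) : det2 (scale2 k M) = k ^ 2 * det2 M.
Proof.
  unfold det2. change (entry (scale2 k M) 0 0) with (k * entry M 0 0).
  change (entry (scale2 k M) 0 1) with (k * entry M 0 1).
  change (entry (scale2 k M) 1 0) with (k * entry M 1 0).
  change (entry (scale2 k M) 1 1) with (k * entry M 1 1). ring.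
Qed.

(** In dimension two the determinant scales by k^-2, so its signed root scales by 1 / k. With k = D
    this makes the function a of (ii) the quotient b / D. *)
Lemma signed_root_det_scale2 (k : R) (M : matrix 2 2) :
  0 < k -> signed_root_det (scale2 (/ k) M) = signed_root_det M / k.
Proof.
  intros Hk. unfold signed_root_det. rewrite det2_scale2.
  assert (Hik : 0 < / k) by (apply Rinv_0_lt_compat; exact Hk).
  rewrite sign_mult, (sign_eq_1 ((/ k) ^ 2)) by (apply pow_lt; exact Hik).
  rewrite Rabs_mult, sqrt_mult by apply Rabs_pos.
  rewrite (Rabs_pos_eq ((/ k) ^ 2)) by (apply pow_le; lra).
  rewrite sqrt_pow2 by lra. unfold Rdiv. ring.
Qed.

(** Both branches have derivative 1 / (2 sqrt |t|). Writing it as the function itself over 2 t gives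
    one formula for both signs and exhibits the logarithmic derivative 1 / (2 t). *)
Lemma is_derive_signed_sqrt (t : R) :
  t <> 0 ->
  is_derive (fun t => sign t * sqrt (Rabs t)) t (sign t * sqrt (Rabs t) / (2 * t)).
Proof.
  intros Ht. destruct (Rtotal_order t 0) as [Hneg | [Hz | Hpos]]; [| lra |].
  - rewrite sign_eq_m1, Rabs_left by exact Hneg.
    apply is_derive_ext_loc with (fun s => - sqrt (- s)).
    + generalize (locally_open_interval (t - 1) 0 t ltac:(lra)). apply filter_imp. intros s Hs.
      rewrite sign_eq_m1, Rabs_left by lra. transitivity (- (1 * sqrt (- s))); [rewrite Rmult_1_l; reflexivity | exact (Ropp_mult_distr_l 1 _)].
    + assert (Hs : 0 < sqrt (- t)) by (apply sqrt_lt_R0; lra).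
      pose proof (sqrt_sqrt (- t) ltac:(lra)) as Hss.
      replace (-1 * sqrt (- t) / (2 * t)) with (- (- (1) / (2 * sqrt (- t)))).
      2: { replace t with (- (sqrt (- t) * sqrt (- t))) at 3 by lra. field. lra. }
      apply (@is_derive_opp R_AbsRing R_NormedModule (fun s => sqrt (- s))).
      apply is_derive_sqrt; [| lra].
      apply (@is_derive_opp R_AbsRing R_NormedModule (fun s => s)).
      apply (@is_derive_id R_AbsRing).
  - rewrite sign_eq_1, Rabs_pos_eq by lra.
    apply is_derive_ext_loc with sqrt.
    + generalize (locally_open_interval 0 (t + 1) t ltac:(lra)). apply filter_imp. intros s Hs.
      rewrite sign_eq_1, Rabs_pos_eq by lra. exact (eq_sym (Rmult_1_l _)).
    + assert (Hs : 0 < sqrt t) by (apply sqrt_lt_R0; lra).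
      pose proof (sqrt_sqrt t ltac:(lra)) as Hss.
      replace (1 * sqrt t / (2 * t)) with (1 / (2 * sqrt t)).
      2: { replace t with (sqrt t * sqrt t) at 3 by lra. field. lra. }
      apply is_derive_sqrt; [| lra]. apply (@is_derive_id R_AbsRing).
Qed.

(** From b' / b = d' / (2 d) it follows that b'' / b = (d' / (2 d))' + (d' / (2 d))^2, where (d' /
    (2 d))' = d'' / (2 d) - 2 (d' / (2 d))^2. *)
Lemma second_derivative_signed_sqrt (d d1 d2 : R -> R) (l : R) :
  is_derive d l (d1 l) -> is_derive d1 l (d2 l) -> d l <> 0 ->
  let b := fun l => sign (d l) * sqrt (Rabs (d l)) in
  is_derive b l (b l * d1 l / (2 * d l)) /\
  is_derive (fun l => b l * d1 l / (2 * d l)) l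
    ((d2 l / (2 * d l) - (d1 l / (2 * d l)) ^ 2) * b l).
Proof.
  intros Hd Hd1 Hd0 b.
  assert (Hb : is_derive b l (b l * d1 l / (2 * d l))).
  { replace (b l * d1 l / (2 * d l)) with (d1 l * (b l / (2 * d l))) by (field; exact Hd0).
    apply (is_derive_comp (fun t => sign t * sqrt (Rabs t)) d); [| exact Hd].
    apply is_derive_signed_sqrt. exact Hd0. }
  split; [exact Hb |].
  replace ((d2 l / (2 * d l) - (d1 l / (2 * d l)) ^ 2) * b l)
    with (((b l * d1 l / (2 * d l) * d1 l + b l * d2 l) * (2 * d l) - b l * d1 l * (2 * d1 l)) / (2 * d l) ^ 2)
    by (field; exact Hd0).
  apply (is_derive_div (fun l => b l * d1 l) (fun l => 2 * d l)).
  - apply is_derive_Rmult; assumption.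
  - exact (is_derive_scal d l 2 _ Hd).
  - lra.
Qed.

Section Jacobi.

Variables (D : R -> Prop) (e : R -> R) (F : R -> C) (Jac Jac1 : R -> matrix (T := R) 2 2).
Hypothesis HD : vertex_domain D.
Hypothesis HJ : jacobi_map D (fun l => optical_mx (e l) (F l)) Jac Jac1.

Let J i j l := entry (Jac l) i j.
Let J1 i j l := entry (Jac1 l) i j.
Let T i j l := entry (optical_mx (e l) (F l)) i j.

Lemma jacobi_map_D_in (i j : nat) (l : R) :
  (i < 2)%nat -> (j < 2)%nat -> D l ->
  D_in (J i j) (J1 i j) D l /\
  D_in (J1 i j) (fun l => T i 0 l * J 0 j l + T i 1 l * J 1 j l) D l.
Proof.
  intros Hi Hj Hl. destruct HJ as [_ [_ [A1 A2]]]. split; [apply A1; assumption |].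
  apply D_in_change
    with (fun s => entry (Mmult (T := R_Ring) (optical_mx (e s) (F s)) (Jac s)) i j).
  - exact (entry_Mmult (optical_mx (e l) (F l)) (Jac l) i j Hi Hj).
  - apply A2; assumption.
Qed.

(* Symmetry of the tidal matrix makes [J^T J1 - J1^T J] constant, and it
   vanishes at the vertex. *)
Lemma jacobi_map_symmetric (l : R) :
  D l -> J 0 0 l * J1 0 1 l + J 1 0 l * J1 1 1 l = J1 0 0 l * J 0 1 l + J1 1 0 l * J 1 1 l.
Proof.
  intros Hl.
  assert (HJ0 : forall i j, (i < 2)%nat -> (j < 2)%nat -> J i j 0 = 0).
  { intros i j Hi Hj. unfold J, entry. destruct HJ as [-> _].
    unfold Mzero. rewrite coeff_mat_bij by assumption. reflexivity. }
  set (E := fun l => (J 0 0 l * J1 0 1 l + J 1 0 l * J1 1 1 l) - (J1 0 0 l * J 0 1 l + J1 1 0 l * J 1 1 l)).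
  assert (HE0 : E 0 = 0) by (unfold E; rewrite !HJ0 by lia; ring).
  assert (HE : forall s, D s -> D_in E (fun _ => 0) D s).
  { intros s Hs.
    assert (Hj : forall i j, (i < 2)%nat -> (j < 2)%nat -> _) by (intros i j Hi Hj; exact (jacobi_map_D_in i j s Hi Hj Hs)).
    destruct (Hj 0%nat 0%nat) as [A00 B00]; try lia. destruct (Hj 0%nat 1%nat) as [A01 B01]; try lia.
    destruct (Hj 1%nat 0%nat) as [A10 B10]; try lia. destruct (Hj 1%nat 1%nat) as [A11 B11]; try lia.
    eapply D_in_change; [| apply Dminus; apply Dadd; apply Dmult; eassumption].
    (* Symmetry enters here: both off-diagonal entries of the tidal matrix compute to [Im (F s)]. *)
    cbv beta. change (T 1 0 s) with (T 0 1 s). ring. }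
  destruct (HD l Hl) as [Hl0 _].
  assert (HEl : E l = 0); [| unfold E in HEl; lra].
  destruct (Req_dec l 0) as [-> | Hne]; [exact HE0 |].
  destruct (vertex_MVT D E (fun _ => 0) 0 l HD HE) as [c [_ Hc]]; [lra | exact Hl | lra].
Qed.

Lemma entry_deformation_rate (i j : nat) (l : R) :
  (i < 2)%nat -> (j < 2)%nat ->
  entry (deformation_rate Jac Jac1 l) i j =
  J1 i 0 l * entry (inv2 (Jac l)) 0 j + J1 i 1 l * entry (inv2 (Jac l)) 1 j.
Proof. intros Hi Hj. apply entry_Mmult; assumption. Qed.

(** The difference of the two entries is the off-diagonal entry of J^T J1 - J1^T J, divided by det
    J. *)
Lemma deformation_rate_symmetric (l : R) :
  D l -> entry (deformation_rate Jac Jac1 l) 0 1 = entry (deformation_rate Jac Jac1 l) 1 0.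
Proof.
  intros Hl. rewrite !entry_deformation_rate by lia. pose proof (jacobi_map_symmetric l Hl) as H.
  change (entry (inv2 (Jac l)) 0 0) with (J 1 1 l / det2 (Jac l)).
  change (entry (inv2 (Jac l)) 0 1) with (- J 0 1 l / det2 (Jac l)).
  change (entry (inv2 (Jac l)) 1 0) with (- J 1 0 l / det2 (Jac l)).
  change (entry (inv2 (Jac l)) 1 1) with (J 0 0 l / det2 (Jac l)).
  unfold Rdiv. apply Rminus_diag_uniq.
  replace (_ - _) with (((J 0 0 l * J1 0 1 l + J 1 0 l * J1 1 1 l)
    - (J1 0 0 l * J 0 1 l + J1 1 0 l * J 1 1 l)) * / det2 (Jac l)) by ring.
  rewrite H. ring.
Qed.

Let det1 l := J1 0 0 l * J 1 1 l + J 0 0 l * J1 1 1 l - (J1 0 1 l * J 1 0 l + J 0 1 l * J1 1 0 l).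
Let det'' l := 2 * e l * det2 (Jac l) + 2 * det2 (Jac1 l).

(** In the second derivative the terms containing J'' = T J add up to (tr T) det J = 2 e det J, in
    which the trace-free part F cancels; the products of first derivatives add up to 2 det J1. *)
Lemma is_derive_det2_jacobi (l : R) :
  D l -> 0 < l ->
  is_derive (fun s => det2 (Jac s)) l (det1 l) /\ is_derive det1 l (det'' l).
Proof.
  intros Hl Hl0.
  assert (Hj : forall i j, (i < 2)%nat -> (j < 2)%nat ->
    is_derive (J i j) l (J1 i j l) /\ is_derive (J1 i j) l (T i 0 l * J 0 j l + T i 1 l * J 1 j l)).
  { intros i j Hi Hj. destruct (jacobi_map_D_in i j l Hi Hj Hl) as [A1 A2].
    split; [exact (vertex_domain_is_derive D _ _ l HD Hl Hl0 A1)
           | exact (vertex_domain_is_derive D _ _ l HD Hl Hl0 A2)]. }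
  destruct (Hj 0%nat 0%nat) as [A00 B00]; try lia. destruct (Hj 0%nat 1%nat) as [A01 B01]; try lia.
  destruct (Hj 1%nat 0%nat) as [A10 B10]; try lia. destruct (Hj 1%nat 1%nat) as [A11 B11]; try lia.
  split.
  - apply (@is_derive_minus R_AbsRing R_NormedModule (fun s => J 0 0 s * J 1 1 s) (fun s => J 0 1 s * J 1 0 s));
      apply is_derive_Rmult; assumption.
  - replace (det'' l) with
      ((((T 0 0 l * J 0 0 l + T 0 1 l * J 1 0 l) * J 1 1 l + J1 0 0 l * J1 1 1 l)
        + (J1 0 0 l * J1 1 1 l + J 0 0 l * (T 1 0 l * J 0 1 l + T 1 1 l * J 1 1 l)))
       - (((T 0 0 l * J 0 1 l + T 0 1 l * J 1 1 l) * J 1 0 l + J1 0 1 l * J1 1 0 l)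
          + (J1 0 1 l * J1 1 0 l + J 0 1 l * (T 1 0 l * J 0 0 l + T 1 1 l * J 1 0 l)))).
    2: { unfold det'', det2. fold (J 0 0 l) (J 0 1 l) (J 1 0 l) (J 1 1 l).
         fold (J1 0 0 l) (J1 0 1 l) (J1 1 0 l) (J1 1 1 l).
         change (T 0 0 l) with (e l - Re (F l)). change (T 0 1 l) with (Im (F l)).
         change (T 1 0 l) with (Im (F l)). change (T 1 1 l) with (e l + Re (F l)). ring. }
    apply (@is_derive_minus R_AbsRing R_NormedModule
      (fun l => J1 0 0 l * J 1 1 l + J 0 0 l * J1 1 1 l) (fun l => J1 0 1 l * J 1 0 l + J 0 1 l * J1 1 0 l)).
    + apply (@is_derive_plus R_AbsRing R_NormedModule
        (fun l => J1 0 0 l * J 1 1 l) (fun l => J 0 0 l * J1 1 1 l)); apply is_derive_Rmult; assumption.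
    + apply (@is_derive_plus R_AbsRing R_NormedModule
        (fun l => J1 0 1 l * J 1 0 l) (fun l => J 0 1 l * J1 1 0 l)); apply is_derive_Rmult; assumption.
Qed.

(* [d' / (2 d)] is the expansion and [det S = theta^2 - |sigma|^2]. *)
Lemma focusing_coefficient (l th : R) (s : C) :
  det2 (Jac l) <> 0 -> deformation_rate Jac Jac1 l = optical_mx th s ->
  det'' l / (2 * det2 (Jac l)) - (det1 l / (2 * det2 (Jac l))) ^ 2 = e l - Cmod s ^ 2.
Proof.
  intros Hdet HS. set (d := det2 (Jac l)) in *.
  assert (S00 : J1 0 0 l * (J 1 1 l / d) + J1 0 1 l * (- J 1 0 l / d) = th - Re s).
  { transitivity (entry (deformation_rate Jac Jac1 l) 0 0).
    - rewrite entry_deformation_rate by lia. reflexivity.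
    - rewrite HS. reflexivity. }
  assert (S01 : J1 0 0 l * (- J 0 1 l / d) + J1 0 1 l * (J 0 0 l / d) = Im s).
  { transitivity (entry (deformation_rate Jac Jac1 l) 0 1).
    - rewrite entry_deformation_rate by lia. reflexivity.
    - rewrite HS. reflexivity. }
  assert (S10 : J1 1 0 l * (J 1 1 l / d) + J1 1 1 l * (- J 1 0 l / d) = Im s).
  { transitivity (entry (deformation_rate Jac Jac1 l) 1 0).
    - rewrite entry_deformation_rate by lia. reflexivity.
    - rewrite HS. reflexivity. }
  assert (S11 : J1 1 0 l * (- J 0 1 l / d) + J1 1 1 l * (J 0 0 l / d) = th + Re s).
  { transitivity (entry (deformation_rate Jac Jac1 l) 1 1).
    - rewrite entry_deformation_rate by lia. reflexivity.
    - rewrite HS. reflexivity. }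
  assert (Htr : det1 l / (2 * d) = th).
  { replace (det1 l / (2 * d)) with
      ((J1 0 0 l * (J 1 1 l / d) + J1 0 1 l * (- J 1 0 l / d)
        + (J1 1 0 l * (- J 0 1 l / d) + J1 1 1 l * (J 0 0 l / d))) / 2).
    - rewrite S00, S11. field.
    - unfold det1. field. exact Hdet. }
  assert (Hdt : det2 (Jac1 l) / d = (th - Re s) * (th + Re s) - Im s * Im s).
  { rewrite <- S00, <- S11. rewrite <- S01 at 1. rewrite <- S10.
    assert (Hd : d = J 0 0 l * J 1 1 l - J 0 1 l * J 1 0 l) by reflexivity.
    unfold det2. fold (J1 0 0 l) (J1 0 1 l) (J1 1 0 l) (J1 1 1 l).
    (* The inverse carries [d] as an atom, whereas det (J1 J^-1) = det J1 / det J becomes a field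
       identity only after one factor [d] is expanded into the entries of J. *)
    transitivity ((J1 0 0 l * J1 1 1 l - J1 0 1 l * J1 1 0 l) * (J 0 0 l * J 1 1 l - J 0 1 l * J 1 0 l) / (d * d)).
    - rewrite <- Hd. field. exact Hdet.
    - field. exact Hdet. }
  assert (Hmod : Cmod s ^ 2 = Re s ^ 2 + Im s ^ 2).
  { unfold Cmod. rewrite pow2_sqrt; [reflexivity |]. apply Rplus_le_le_0_compat; apply pow2_ge_0. }
  rewrite Htr, Hmod. unfold det''. fold d.
  replace ((2 * e l * d + 2 * det2 (Jac1 l)) / (2 * d)) with (e l + det2 (Jac1 l) / d) by (field; exact Hdet).
  rewrite Hdt. ring.
Qed.

Lemma focusing_equation (l th : R) (s : C) :
  D l -> 0 < l -> det2 (Jac l) <> 0 -> deformation_rate Jac Jac1 l = optical_mx th s ->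
  let b1 := fun l => signed_root_det (Jac l) * det1 l / (2 * det2 (Jac l)) in
  is_derive (fun l => signed_root_det (Jac l)) l (b1 l) /\
  is_derive b1 l ((e l - Cmod s ^ 2) * signed_root_det (Jac l)).
Proof.
  intros Hl Hl0 Hdet HS b1. destruct (is_derive_det2_jacobi l Hl Hl0) as [Hd Hd1].
  rewrite <- (focusing_coefficient l th s Hdet HS).
  exact (second_derivative_signed_sqrt (fun s => det2 (Jac s)) det1 det'' l Hd Hd1 Hdet).
Qed.

End Jacobi.

(** * The on-average Friedmann universe *)

Section Friedmann.

Variables (c H0 Om alpha : R).
Hypotheses (Hc : 0 < c) (HH0 : 0 < H0) (HOm : 0 <= Om) (Halpha : 0 <= alpha <= 1).

Let k := c / H0.
Let nonneg z := 0 <= z.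
Let dom := affine_dom c H0 Om.
Let y z := sqrt (Om * z + 1).
(** This is dlambda/dz, the weight of the comparison systems. *)
Let m z := k * / ((1 + z) ^ 3 * y z).

Local Lemma k_pos : 0 < k.
Proof. apply Rdiv_lt_0_compat; assumption. Qed.

Local Lemma y_pos (z : R) : 0 <= z -> 0 < y z.
Proof. intros Hz. apply sqrt_lt_R0. nra. Qed.

Local Lemma y_sqr (z : R) : 0 <= z -> y z * y z = Om * z + 1.
Proof. intros Hz. apply sqrt_sqrt. nra. Qed.

Local Lemma m_pos (z : R) : 0 <= z -> 0 < m z.
Proof.
  intros Hz. apply Rmult_lt_0_compat; [exact k_pos |]. apply Rinv_0_lt_compat.
  apply Rmult_lt_0_compat; [apply pow_lt; lra | apply y_pos; exact Hz].
Qed.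

Local Lemma is_derive_y (z : R) : 0 < Om * z + 1 -> is_derive y z (Om / (2 * y z)).
Proof.
  intros Hz. apply (is_derive_sqrt (fun z => Om * z + 1)); [| exact Hz].
  auto_derive; [exact I | ring].
Qed.

(** The bound -1 / (Om + 1) keeps both 1 + z and Om z + 1 positive and leaves room to the left of 0,
    so that [affine] has a two-sided derivative even at the vertex. *)
Local Lemma continuous_affine_integrand (z : R) :
  - / (Om + 1) < z -> continuous (fun s => / ((1 + s) ^ 3 * y s)) z.
Proof.
  intros Hz.
  assert (Hi : (Om + 1) * / (Om + 1) = 1) by (field; lra).
  assert (Hi0 : 0 < / (Om + 1)) by (apply Rinv_0_lt_compat; lra).
  assert (H1 : 0 < 1 + z) by nra.
  assert (H2 : 0 < Om * z + 1) by nra.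
  assert (Hy : 0 < y z) by (apply sqrt_lt_R0; exact H2).
  apply (continuous_comp (fun s => (1 + s) ^ 3 * y s) Rinv).
  - apply (is_derive_continuous (fun s => (1 + s) ^ 3 * y s) z
      (3 * (1 + z) ^ 2 * y z + (1 + z) ^ 3 * (Om / (2 * y z)))).
    apply is_derive_Rmult; [| apply is_derive_y; exact H2].
    auto_derive; [exact I | ring].
  - apply continuous_Rinv. apply Rgt_not_eq, Rmult_lt_0_compat; [apply pow_lt |]; assumption.
Qed.

Lemma is_derive_affine (z : R) : 0 <= z -> is_derive (affine c H0 Om) z (m z).
Proof.
  intros Hz. assert (Hi0 : 0 < / (Om + 1)) by (apply Rinv_0_lt_compat; lra).
  apply (is_derive_scal (fun z => RInt (fun s => / ((1 + s) ^ 3 * y s)) 0 z)).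
  apply (is_derive_RInt (fun s => / ((1 + s) ^ 3 * y s)) (fun z => RInt (fun s => / ((1 + s) ^ 3 * y s)) 0 z) 0 z); [| apply continuous_affine_integrand; lra].
  assert (Hloc : locally z (fun s => - / (Om + 1) < s < z + 1)) by (apply locally_open_interval; lra).
  revert Hloc. apply filter_imp. intros s Hs.
  apply (RInt_correct (fun s => / ((1 + s) ^ 3 * y s))).
  apply (ex_RInt_continuous (fun s => / ((1 + s) ^ 3 * y s))). intros t Ht.
  apply continuous_affine_integrand. unfold Rmin, Rmax in Ht. destruct (Rle_dec 0 s); lra.
Qed.

Lemma continuity_affine (z : R) : 0 <= z -> continuity_pt (affine c H0 Om) z.
Proof.
  intros Hz. apply continuity_pt_filterlim.
  exact (is_derive_continuous (affine c H0 Om) z _ (is_derive_affine z Hz)).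
Qed.

Lemma affine_0 : affine c H0 Om 0 = 0.
Proof. unfold affine. rewrite RInt_point. apply Rmult_0_r. Qed.

Lemma affine_incr (z z' : R) : 0 <= z < z' -> affine c H0 Om z < affine c H0 Om z'.
Proof.
  intros Hz. destruct (MVT_is_derive (affine c H0 Om) m z z') as [s [Hs He]].
  - lra.
  - intros s Hs. apply is_derive_affine. lra.
  - intros s Hs. apply continuity_affine. lra.
  - pose proof (m_pos s ltac:(lra)). assert (0 < m s * (z' - z)) by (apply Rmult_lt_0_compat; lra). lra.
Qed.

Lemma affine_incr_inv (z z' : R) :
  0 <= z -> 0 <= z' -> affine c H0 Om z < affine c H0 Om z' -> z < z'.
Proof.
  intros Hz Hz' H. apply Rnot_le_lt. intros [Hlt | ->]; [| lra].
  pose proof (affine_incr z' z ltac:(lra)). lra.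
Qed.

Lemma redshift_affine (z : R) : 0 <= z -> redshift c H0 Om (affine c H0 Om z) = z.
Proof.
  intros Hz.
  assert (Hinj : forall s, 0 <= s /\ affine c H0 Om s = affine c H0 Om z -> s = z).
  { intros s [Hs He]. destruct (Rtotal_order s z) as [Hlt | [-> | Hlt]]; [| reflexivity |].
    - pose proof (affine_incr s z ltac:(lra)). lra.
    - pose proof (affine_incr z s ltac:(lra)). lra. }
  apply Hinj.
  apply (iota_correct (fun s : R => 0 <= s /\ affine c H0 Om s = affine c H0 Om z)).
  exists z. split; [split; auto |]. intros s Hs. symmetry. apply Hinj. exact Hs.
Qed.

Lemma affine_in_dom (z : R) : 0 <= z -> dom (affine c H0 Om z).
Proof. intros Hz. exists z. auto. Qed.

Lemma affine_dom_pos (l : R) : dom l -> 0 < l -> exists z, 0 < z /\ affine c H0 Om z = l.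
Proof.
  intros [z [Hz <-]] Hl. exists z. split; [| reflexivity].
  apply affine_incr_inv; [lra | exact Hz |]. rewrite affine_0. exact Hl.
Qed.

Lemma affine_dom_vertex_domain : vertex_domain dom.
Proof.
  intros l [z [Hz <-]]. split.
  - rewrite <- affine_0. destruct Hz as [Hz | <-]; [left; apply affine_incr; lra | right; reflexivity].
  - exists (affine c H0 Om (z + 1)). split; [apply affine_incr; lra |]. intros t Ht.
    destruct (Ranalysis5.f_interv_is_interv (affine c H0 Om) 0 (z + 1) t) as [s [Hs <-]].
    + lra.
    + rewrite affine_0. lra.
    + intros s Hs. apply continuity_affine. lra.
    + apply affine_in_dom. lra.
Qed.

Lemma nonneg_vertex_domain : vertex_domain nonneg.
Proof.
  intros z Hz. split; [exact Hz |]. exists (z + 1). split; [lra |]. intros t [Ht _]. exact Ht.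
Qed.

Let u z := y z / (1 + z) ^ 2.
(** This is du/dlambda. Dividing du/dz by [m] cancels the square root and leaves a linear function
    of z, whose z-derivative is the constant -3 Om / (2 k). *)
Let u1 z := / k * (Om / 2 * (1 + z) - 2 * (Om * z + 1)).

(* [u] is the solution of the case [alpha = 1] that vanishes at infinite
   redshift. *)
Local Lemma u_ode (z : R) :
  0 <= z ->
  is_derive u z (m z * u1 z) /\
  is_derive u1 z (m z * (- (3 / 2) * (H0 / c) ^ 2 * Om * (1 + z) ^ 5 * u z)).
Proof.
  intros Hz. pose proof k_pos as Hk. pose proof (y_pos z Hz) as Hy. pose proof (y_sqr z Hz) as Hyy. split.
  - replace (m z * u1 z) with ((Om / (2 * y z) * (1 + z) ^ 2 - y z * (2 * (1 + z))) / ((1 + z) ^ 2) ^ 2).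
    + apply (is_derive_div y (fun z => (1 + z) ^ 2)).
      * apply is_derive_y. nra.
      * auto_derive; [exact I | ring].
      * apply pow_nonzero. lra.
    + unfold m, u1. rewrite <- Hyy. field. repeat split; lra.
  - replace (m z * (- (3 / 2) * (H0 / c) ^ 2 * Om * (1 + z) ^ 5 * u z)) with (/ k * (Om / 2 * 1 - 2 * Om)).
    + unfold u1. auto_derive; [exact I | field; lra].
    + unfold m, u, k. field. repeat split; lra.
Qed.

(** * The empty-cone distance in the redshift coordinate, and chi *)

Variables (r D1 : R -> R).
Let D l := k * r (redshift c H0 Om l).
Hypothesis HD : vertex_ivp dom (R_bg c H0 Om alpha) D D1.

Let v z := D (affine c H0 Om z).
Let v1 z := D1 (affine c H0 Om z).
Let g z := R_bg c H0 Om alpha (affine c H0 Om z).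

Local Lemma v_r (z : R) : 0 <= z -> v z = k * r z.
Proof. intros Hz. unfold v, D. rewrite redshift_affine by exact Hz. reflexivity. Qed.

(** Chain rule along [affine]. [Dcomp] differentiates relative to those redshifts that [affine]
    sends into [dom], and these are all of [nonneg]. *)
Local Lemma v_ode (z : R) :
  0 <= z -> D_in v (fun s => m s * v1 s) nonneg z /\ D_in v1 (fun s => m s * (g s * v s)) nonneg z.
Proof.
  intros Hz. destruct HD as [_ [_ Hode]].
  destruct (Hode (affine c H0 Om z) (affine_in_dom z Hz)) as [A1 A2].
  assert (Haff : D_in (affine c H0 Om) m nonneg z).
  { apply is_derive_D_in, is_derive_affine. exact Hz. }
  assert (Hsub : forall s, nonneg s -> Dgf nonneg dom (affine c H0 Om) s).
  { intros s Hs. split; [exact Hs | apply affine_in_dom; exact Hs]. }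
  split; (eapply D_in_subset; [exact Hsub |]).
  - exact (Dcomp nonneg dom _ _ _ _ z Haff A1).
  - exact (Dcomp nonneg dom _ _ _ _ z Haff A2).
Qed.

Local Lemma u_pos (z : R) : nonneg z -> 0 < u z.
Proof.
  intros Hz. apply Rdiv_lt_0_compat; [apply y_pos; exact Hz | apply pow_lt; unfold nonneg in Hz; lra].
Qed.

(** The source is -alpha times a nonnegative quantity and alpha <= 1: a partly emptied cone focuses
    no more than the full one. *)
Local Lemma g_ge (z : R) : nonneg z -> - (3 / 2) * (H0 / c) ^ 2 * Om * (1 + z) ^ 5 <= g z.
Proof.
  intros Hz. unfold g, R_bg. rewrite redshift_affine by exact Hz.
  assert (0 <= (H0 / c) ^ 2 * Om * (1 + z) ^ 5).
  { apply Rmult_le_pos; [apply Rmult_le_pos; [apply pow2_ge_0 | exact HOm] |].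
    apply pow_le. unfold nonneg in Hz. lra. }
  nra.
Qed.

Local Lemma v_0 : v 0 = 0.
Proof. unfold v. rewrite affine_0. apply HD. Qed.

Local Lemma v1_0 : 0 < v1 0.
Proof. unfold v1. rewrite affine_0. destruct HD as [_ [-> _]]. lra. Qed.

Local Lemma u_D_in (z : R) :
  nonneg z -> D_in u (fun s => m s * u1 s) nonneg z /\
  D_in u1 (fun s => m s * (- (3 / 2) * (H0 / c) ^ 2 * Om * (1 + s) ^ 5 * u s)) nonneg z.
Proof. intros Hz. destruct (u_ode z Hz). split; apply is_derive_D_in; assumption. Qed.

Local Lemma v_pos (z : R) : 0 < z -> 0 < v z.
Proof.
  intros Hz.
  apply (sturm_pos nonneg m g (fun s => - (3 / 2) * (H0 / c) ^ 2 * Om * (1 + s) ^ 5) v v1 u u1).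
  - exact nonneg_vertex_domain.
  - apply Rle_refl.
  - exact m_pos.
  - intros s Hs. apply v_ode; exact Hs.
  - intros s Hs. apply v_ode; exact Hs.
  - intros s Hs. apply u_D_in; exact Hs.
  - intros s Hs. apply (u_D_in s Hs).
  - exact u_pos.
  - exact g_ge.
  - exact v_0.
  - exact v1_0.
  - unfold nonneg. lra.
  - exact Hz.
Qed.

Lemma distance_pos (z : R) : 0 < z -> 0 < r z.
Proof.
  intros Hz. pose proof (v_pos z Hz) as Hv. rewrite v_r in Hv by lra. pose proof k_pos. nra.
Qed.

(** The factors k^2 in k m and in v^2 = k^2 r^2 cancel. Dividing by m = dlambda/dz then gives
    dchi/dlambda = -k / D^2, the form required by [reduced_second_derivative]. *)
Local Lemma chi_integrand_v (z : R) : 0 <= z -> v z <> 0 -> chi_integrand Om r z = k * m z / v z ^ 2.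
Proof.
  intros Hz Hv. rewrite v_r in * by exact Hz. pose proof k_pos. pose proof (y_pos z Hz).
  unfold chi_integrand, m. fold (y z). field. repeat split; try lra. intros Hr. apply Hv. rewrite Hr. ring.
Qed.

Local Lemma chi_integrand_pos (z : R) : 0 < z -> 0 < chi_integrand Om r z.
Proof.
  intros Hz. pose proof (v_pos z Hz). rewrite chi_integrand_v by lra.
  apply Rdiv_lt_0_compat; [| apply pow_lt; assumption].
  apply Rmult_lt_0_compat; [exact k_pos | apply m_pos; lra].
Qed.

(** The regularity of [r] comes through the differential equation for [D], so the integrand is first
    rewritten in terms of [v]. *)
Local Lemma continuous_chi_integrand (z : R) : 0 < z -> continuous (chi_integrand Om r) z.
Proof.
  intros Hz. pose proof (v_pos z Hz) as Hv.
  apply continuous_ext_loc with (fun s => mult (k * m s) (/ (v s * v s))).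
  - generalize (locally_open_interval 0 (z + 1) z ltac:(lra)). apply filter_imp. intros s Hs.
    pose proof (v_pos s ltac:(lra)). rewrite chi_integrand_v by lra. unfold mult; simpl. field. lra.
  - assert (Hvd : is_derive v z (m z * v1 z)).
    { apply (vertex_domain_is_derive nonneg v (fun s => m s * v1 s)); auto using nonneg_vertex_domain.
      - unfold nonneg; lra.
      - apply v_ode. lra. }
    apply (@continuous_mult R_UniformSpace R_AbsRing).
    + apply (@continuous_scal_r R_UniformSpace R_AbsRing R_NormedModule k m).
      apply (@continuous_scal_r R_UniformSpace R_AbsRing R_NormedModule k (fun s => / ((1 + s) ^ 3 * y s))).
      apply continuous_affine_integrand. assert (0 < / (Om + 1)) by (apply Rinv_0_lt_compat; lra). lra.
    + apply (continuous_comp (fun s => v s * v s) Rinv).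
      * exact (is_derive_continuous _ _ _ (is_derive_Rmult v v z _ _ Hvd Hvd)).
      * apply continuous_Rinv. apply Rgt_not_eq, Rmult_lt_0_compat; assumption.
Qed.

Lemma ex_chi (s : R) :
  0 < s -> ex_RInt_gen (chi_integrand Om r) (at_point s) (Rbar_locally p_infty).
Proof.
  intros Hs. apply (ex_RInt_gen_bounded _ s (k * u s / (v1 0 * u 0 * v s))).
  - intros t Ht. split; [apply continuous_chi_integrand; lra |]. left. apply chi_integrand_pos. lra.
  - intros Z HZ.
    apply (sturm_tail_bound nonneg m g (fun s => - (3 / 2) * (H0 / c) ^ 2 * Om * (1 + s) ^ 5) v v1 u u1).
    + exact nonneg_vertex_domain.
    + apply Rle_refl.
    + exact m_pos.
    + intros t Ht. apply v_ode; exact Ht.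
    + intros t Ht. apply v_ode; exact Ht.
    + intros t Ht. apply u_D_in; exact Ht.
    + intros t Ht. apply (u_D_in t Ht).
    + exact u_pos.
    + exact g_ge.
    + exact v_0.
    + exact v1_0.
    + intros t Ht Ht0. split; [apply continuous_chi_integrand; exact Ht0 |].
      right. apply chi_integrand_v; [exact Ht |]. apply Rgt_not_eq, v_pos. exact Ht0.
    + left. exact k_pos.
    + lra.
    + unfold nonneg. lra.
Qed.

Local Lemma is_RInt_gen_chi (s : R) :
  0 < s -> is_RInt_gen (chi_integrand Om r) (at_point s) (Rbar_locally p_infty) (chi Om r s).
Proof. intros Hs. apply (RInt_gen_correct (chi_integrand Om r)). apply ex_chi. exact Hs. Qed.

Lemma chi_decr (s t : R) : 0 < s < t -> chi Om r t < chi Om r s.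
Proof.
  intros Hst.
  apply (@tail_integral_decr (Rbar_locally p_infty) (chi_integrand Om r) (chi Om r) _).
  - lra.
  - intros z Hz. split; [apply continuous_chi_integrand | apply chi_integrand_pos]; lra.
  - apply is_RInt_gen_chi. lra.
  - apply is_RInt_gen_chi. lra.
Qed.

(** chi composed with [redshift] is chi regarded as a function of the affine parameter, so
    [is_derive_wrt] with [affine] in the role of [x] gives the derivative of chi divided by [m],
    without differentiating the inverse function. *)
Lemma is_derive_chi_redshift (l : R) :
  dom l -> 0 < l ->
  is_derive (fun l => chi Om r (redshift c H0 Om l)) l (- k / D l ^ 2).
Proof.
  intros Hl Hl0. destruct (affine_dom_pos l Hl Hl0) as [s [Hs <-]].
  pose proof (v_pos s Hs) as Hv. pose proof (m_pos s ltac:(lra)) as Hm.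
  replace (- k / D (affine c H0 Om s) ^ 2) with (- chi_integrand Om r s / m s).
  2: { rewrite chi_integrand_v by lra. fold (v s). field. lra. }
  apply is_derive_wrt with (chi Om r).
  - generalize (locally_open_interval 0 (s + 1) s ltac:(lra)). apply filter_imp. intros t Ht. split.
    + exact (is_derive_continuous _ _ _ (is_derive_affine t ltac:(lra))).
    + rewrite redshift_affine by lra. reflexivity.
  - apply is_derive_affine. lra.
  - lra.
  - apply (@is_derive_tail_integral (Rbar_locally p_infty) (chi_integrand Om r) (chi Om r) _).
    generalize (locally_open_interval 0 (s + 1) s ltac:(lra)). apply filter_imp. intros t Ht.
    split; [apply continuous_chi_integrand | apply is_RInt_gen_chi]; lra.
Qed.

Lemma distance_along_ray_pos (l : R) : dom l -> 0 < l -> 0 < D l.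
Proof. intros Hl Hl0. destruct (affine_dom_pos l Hl Hl0) as [s [Hs <-]]. exact (v_pos s Hs). Qed.

Lemma chi_redshift_decr (l l' : R) :
  dom l -> dom l' -> 0 < l -> l < l' ->
  chi Om r (redshift c H0 Om l') < chi Om r (redshift c H0 Om l).
Proof.
  intros Hl Hl' Hl0 Hll.
  destruct (affine_dom_pos l Hl Hl0) as [s [Hs <-]].
  destruct (affine_dom_pos l' Hl' ltac:(lra)) as [s' [Hs' <-]].
  rewrite !redshift_affine by lra. apply chi_decr. split; [exact Hs |].
  apply affine_incr_inv; lra.
Qed.

(** * The focusing equation with matter clumps *)

Variables (Rcl : R -> R) (F : R -> C) (Jac Jac1 : R -> matrix (T := R) 2 2).
Hypothesis HJ : jacobi_map dom
  (fun l => optical_mx (R_bg c H0 Om alpha l + Rcl l) (F l)) Jac Jac1.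

(** On the interval b and D solve linear equations whose potentials differ by q = Rcl - |sigma|^2.
    [reduced_second_derivative] is local, so it applies between any two consecutive conjugate points
    and not only next to the vertex. *)
Lemma relative_optical_focusing (theta : R -> R) (sigma : R -> C) (l1 l2 : R) :
  (forall l, l1 < l < l2 -> dom l /\ 0 < l /\ det2 (Jac l) <> 0 /\
     deformation_rate Jac Jac1 l = optical_mx (theta l) (sigma l)) ->
  second_derivative_wrt (fun l => l1 < l < l2)
    (fun l => chi Om r (redshift c H0 Om l))
    (fun l => signed_root_det (scale2 (/ D l) (Jac l)))
    (fun l => k ^ 2 * r (redshift c H0 Om l) ^ 4 * (Rcl l - Cmod (sigma l) ^ 2)
              * signed_root_det (scale2 (/ D l) (Jac l))).
Proof.
  intros Hreg. pose proof k_pos as Hk.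
  assert (HDpos : forall l, l1 < l < l2 -> 0 < D l).
  { intros l Hl. destruct (Hreg l Hl) as [Hd [Hl0 _]]. apply distance_along_ray_pos; assumption. }
  destruct HD as [_ [_ Hode]].
  pose (det1 := fun l => entry (Jac1 l) 0 0 * entry (Jac l) 1 1 + entry (Jac l) 0 0 * entry (Jac1 l) 1 1
    - (entry (Jac1 l) 0 1 * entry (Jac l) 1 0 + entry (Jac l) 0 1 * entry (Jac1 l) 1 0)).
  apply (second_derivative_wrt_ext _ _ (fun l => signed_root_det (Jac l) / D l) _
    (fun l => D l ^ 4 / k ^ 2 * (Rcl l - Cmod (sigma l) ^ 2) * (signed_root_det (Jac l) / D l))).
  - intros l Hl. apply signed_root_det_scale2. apply HDpos. exact Hl.
  - intros l Hl. rewrite signed_root_det_scale2 by (apply HDpos; exact Hl).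
    replace (D l ^ 4 / k ^ 2) with (k ^ 2 * r (redshift c H0 Om l) ^ 4); [reflexivity |].
    unfold D. field. lra.
  - apply (reduced_second_derivative _ k (fun l => signed_root_det (Jac l))
      (fun l => signed_root_det (Jac l) * det1 l / (2 * det2 (Jac l))) D D1 (R_bg c H0 Om alpha)).
    + lra.
    + intros l Hl. apply locally_open_interval. exact Hl.
    + intros l Hl. destruct (Hreg l Hl) as [Hd [Hl0 [Hdet HS]]].
      destruct (focusing_equation dom _ F Jac Jac1 affine_dom_vertex_domain HJ l _ _ Hd Hl0 Hdet HS) as [A1 A2].
      split; [exact A1 |].
      replace (R_bg c H0 Om alpha l + (Rcl l - Cmod (sigma l) ^ 2))
        with (R_bg c H0 Om alpha l + Rcl l - Cmod (sigma l) ^ 2) by ring.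
      exact A2.
    + intros l Hl. destruct (Hreg l Hl) as [Hd [Hl0 _]]. destruct (Hode l Hd) as [A1 A2].
      split; [exact (vertex_domain_is_derive dom _ _ l affine_dom_vertex_domain Hd Hl0 A1)
             | exact (vertex_domain_is_derive dom _ _ l affine_dom_vertex_domain Hd Hl0 A2)].
    + intros l Hl. apply Rgt_not_eq, HDpos. exact Hl.
    + intros l Hl. destruct (Hreg l Hl) as [Hd [Hl0 _]]. apply is_derive_chi_redshift; assumption.
Qed.

End Friedmann.

Theorem mainTheorem5 :
  (forall (lmax : R) (h q w w1 v v1 X : R -> R),
    0 < lmax ->
    let I0 := fun l : R => 0 <= l < lmax in
    let I := fun l : R => 0 < l < lmax in
    continuous_on I0 h ->
    continuous_on I0 q ->
    vertex_ivp I0 (fun l => h l + q l) w w1 ->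
    vertex_ivp I0 h v v1 ->
    (forall l, I l -> 0 < v l) ->
    (forall l, I l ->
      is_RInt_gen (fun s => / v s ^ 2) (at_point l) (at_left lmax) (X l)) ->
    let a := fun l : R => w l / v l in
    (forall l l', I l -> I l' -> l < l' -> X l' < X l) /\
    second_derivative_wrt I X a (fun l => v l ^ 4 * q l * a l) /\
    filterlim a (at_right 0) (locally 1) /\
    (forall l, I l -> ex_derive a l) /\
    filterlim (Derive a) (at_right 0) (locally 0))
  /\
  (forall (c H0 Om alpha : R) (r D1 Rcl : R -> R) (F : R -> C)
      (Jac Jac1 : R -> matrix 2 2),
    0 < c -> 0 < H0 -> 0 <= Om -> 0 <= alpha <= 1 ->
    let dom := affine_dom c H0 Om in
    let z := redshift c H0 Om in
    let D := fun l : R => c / H0 * r (z l) in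
    let T := fun l : R => optical_mx (R_bg c H0 Om alpha l + Rcl l) (F l) in
    vertex_ivp dom (R_bg c H0 Om alpha) D D1 ->
    continuous_on dom Rcl ->
    continuous_on dom F ->
    jacobi_map dom T Jac Jac1 ->
    let S := deformation_rate Jac Jac1 in
    let regular := fun l : R => dom l /\ 0 < l /\ ~ conjugate_point dom Jac l in
    let x := fun l : R => chi Om r (z l) in
    let a := fun l : R => signed_root_det (scale2 (/ D l) (Jac l)) in
    (forall s, 0 < s ->
      0 < r s /\
      ex_RInt_gen (chi_integrand Om r) (at_point s) (Rbar_locally p_infty)) /\
    (forall l l', dom l -> dom l' -> 0 < l -> l < l' -> x l' < x l) /\
    (forall l, regular l -> entry (S l) 0 1 = entry (S l) 1 0) /\
    (forall (theta : R -> R) (sigma : R -> C),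
      (forall l, regular l -> S l = optical_mx (theta l) (sigma l)) ->
      forall l1 l2 : R,
      (forall l, l1 < l < l2 -> regular l) ->
      second_derivative_wrt (fun l => l1 < l < l2) x a
        (fun l => (c / H0) ^ 2 * r (z l) ^ 4
                  * (Rcl l - Cmod (sigma l) ^ 2) * a l))).
Proof.
  split.
  - intros lmax h q w w1 v v1 X Hlmax I0 I _. apply relative_focusing. exact Hlmax.
  - intros c H0 Om alpha r D1 Rcl F Jac Jac1 Hc HH0 HOm Halpha dom z D T HD _ _ HJ S regular x a.
    assert (Hdet : forall l, regular l -> det2 (Jac l) <> 0).
    { intros l [Hl [Hl0 Hn]] Hz. apply Hn. repeat split; assumption. }
    split; [| split; [| split]].
    + intros s Hs. split.
      * exact (distance_pos c H0 Om alpha Hc HH0 HOm Halpha r D1 HD s Hs).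
      * exact (ex_chi c H0 Om alpha Hc HH0 HOm Halpha r D1 HD s Hs).
    + exact (chi_redshift_decr c H0 Om alpha Hc HH0 HOm Halpha r D1 HD).
    + intros l [Hl _].
      exact (deformation_rate_symmetric dom _ F Jac Jac1
        (affine_dom_vertex_domain c H0 Om Hc HH0 HOm) HJ l Hl).
    + intros theta sigma HS l1 l2 Hreg.
      apply (relative_optical_focusing c H0 Om alpha Hc HH0 HOm Halpha r D1 HD Rcl F Jac Jac1 HJ theta).
      intros l Hl. specialize (Hreg l Hl). split; [apply Hreg |]. split; [apply Hreg |].
      split; [exact (Hdet l Hreg) | exact (HS l Hreg)].
Qed.
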